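(* Let $f:\mathbb{R}^n\to\mathbb{R}$ and the randomized stochastic quasi-Newton method RSQN be such that AS.1, AS.2, AS.3 and AS.4 hold. Let $\epsilon>0$, let $\tilde D>0$ be a constant, and put $D_f:=f(x_1)-f^{low}$, $$C_1=\frac{4\sigma M^2D_f}{m^2\sqrt{\tilde D}}+\sigma L\sqrt{\tilde D},\qquad C_2=\frac{4LM^2D_f}{m^2}.$$ Let the positive integer $\bar N$ (the total number of oracle calls available for computing the stochastic gradients $G_k$ over all iterations) satisfy $$\bar N\ge\max\left\{\frac{C_1^2}{\epsilon^2}+\frac{4C_2}{\epsilon},\ \frac{\sigma^2}{L^2\tilde D}\right\}.$$ Run RSQN with constant batch size $$m_k=\bar m:=\left\lceil\min\left\{\bar N,\max\left\{1,\frac{\sigma}{L}\sqrt{\frac{\bar N}{\tilde D}}\right\}\right\}\right\rceil,$$ maximum iteration number $N=\lfloor\bar N/\bar m\rfloor$, stepsizes $\alpha_k=m/(LM^2)$ for $k=1,\dots,N$, and $$P_R(k)=\frac{m\alpha_k-LM^2\alpha_k^2/2}{\sum_{j=1}^N(m\alpha_j-LM^2\alpha_j^2/2)},\qquad k=1,\dots,N.$$ Then $$\mathbb{E}[\|\nabla f(x_R)\|^2]\le\epsilon,$$ where the expectation is taken with respect to $R$ and $\xi_{[N]}$. Consequently, to achieve $\mathbb{E}[\|\nabla f(x_R)\|^2]\le\epsilon$, the number of oracle calls needed to compute the $G_k$ is at most of order $O(\epsilon^{-2})$ (as $\epsilon\to0$, with the other parameters fixed).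
   Context: Problem: minimize a (possibly nonconvex) $f$ over $\mathbb{R}^n$, using only stochastic gradients $G(x,\xi)\in\mathbb{R}^n$ returned by calls to a stochastic first-order oracle (one call per evaluation of $G(x,\xi)$), where $\xi$ is a random variable whose distribution is supported on a set $\Xi\subseteq\mathbb{R}^d$ not depending on $x$. Algorithm RSQN. Given: a maximum iteration number $N$, a (deterministic) point $x_1\in\mathbb{R}^n$, a positive definite $B_1\in\mathbb{R}^{n\times n}$, stepsizes $\alpha_k$, batch sizes $m_k\ge1$ (integers), positive safeguard parameters $\zeta_k$. Choose $R$ at random in $\{1,\dots,N\}$ with probability mass function $P_R$, independently of all the gradient samples. For $k=1,\dots,R$: $$G_k=\frac1{m_k}\sum_{i=1}^{m_k}G(x_k,\xi_{k,i}),\qquad x_{k+1}=x_k-\alpha_k(B_k^{-1}+\zeta_kI)G_k,$$ and then a symmetric positive definite matrix $B_{k+1}$ is generated (by any rule such that AS.3 and AS.4 below hold). The output is $x_R$. (The iterates $x_1,\dots,x_N$ are regarded as defined by this recursion for all $k\le N$.) Write $\xi_k=(\xi_{k,1},\dots,\xi_{k,m_k})$ and $\xi_{[k]}=(\xi_1,\dots,\xi_k)$. Oracle calls possibly used in generating $B_{k+1}$ are not counted here. Assumptions. AS.1: $f$ is continuously differentiable, $f(x)\ge f^{low}$ for all $x\in\mathbb{R}^n$, and $\nabla f$ is globally Lipschitz with constant $L>0$. AS.2: all samples $\xi_{k,i}$ are mutually independent (so $\xi_k$ is independent of $\xi_{[k-1]}$ and hence of $x_k$), and for every $k$ and $i$,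 taking expectation over $\xi_{k,i}$ with $x_k$ fixed, $\mathbb{E}_{\xi_{k,i}}[G(x_k,\xi_{k,i})]=\nabla f(x_k)$ and $\mathbb{E}_{\xi_{k,i}}[\|G(x_k,\xi_{k,i})-\nabla f(x_k)\|^2]\le\sigma^2$, where $\sigma>0$. AS.3: there are positive scalars $m,M$ with $mI\preceq B_k^{-1}+\zeta_kI\preceq MI$ for all $k$. AS.4: for every $k\ge2$, the random matrix $B_k$ depends only on $\xi_{[k-1]}$. $\|\cdot\|$ is the Euclidean norm. *)

(* Defs.v *)
From HB Require Import structures.
From mathcomp Require Export all_boot all_order all_algebra.
From mathcomp Require Export finmap.
From mathcomp Require Export all_classical all_reals all_analysis.

Set Implicit Arguments.
Unset Strict Implicit.
Unset Printing Implicit Defensive.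

Import Order.TTheory GRing.Theory Num.Theory.
Import numFieldNormedType.Exports.

Local Open Scope classical_set_scope.
Local Open Scope ring_scope.

(* The norm that the library puts on matrices is the sup norm; it induces the
   right topology (hence the right notions of differentiability, continuity
   and Borel set), but the Euclidean norm has to be defined. *)
Definition enorm (R : realType) (n : nat) (v : 'cV[R]_n) : R :=
  Num.sqrt (\sum_i v i 0 ^+ 2).

Definition gradient (R : realType) (n : nat) (f : 'cV[R]_n -> R)
    (x : 'cV[R]_n) : 'cV[R]_n :=
  \col_i 'D_(delta_mx i 0) f x.

Definition psd (R : realType) (n : nat) (A : 'M[R]_n) : Prop :=
  A \is symmetricmx /\ forall v : 'cV[R]_n, 0 <= (v^T *m A *m v) 0 0.

Definition spd (R : realType) (n : nat) (A : 'M[R]_n) : Prop :=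
  A \is symmetricmx /\
  forall v : 'cV[R]_n, v != 0 -> 0 < (v^T *m A *m v) 0 0.

Definition loewner_le (R : realType) (n : nat) (A B : 'M[R]_n) : Prop :=
  psd (B - A).

(* 'M[R]_(p, q) with its Borel sigma-algebra. *)
Definition borel_mx (R : realType) (p q : nat) :=
  g_sigma_algebraType (@open 'M[R]_(p, q)).

Notation borel_cV R n := (borel_mx R n 1).

Section independence.
Context (R : realType) (dO : measure_display) (Omega : measurableType dO)
  (P : probability Omega R).

Definition mutually_independent (I : choiceType) (dT : measure_display)
    (T : measurableType dT) (D : set I) (X : I -> Omega -> T) : Prop :=
  forall (J : {fset I}) (A : I -> set T),
    [set` J] `<=` D -> (forall i, i \in J -> measurable (A i)) ->
    P (\bigcap_(i in [set` J]) (X i @^-1` A i)) =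
    (\prod_(i <- J) P (X i @^-1` A i))%E.

Definition independent_systems (F1 F2 : set (set Omega)) : Prop :=
  forall A1 A2, F1 A1 -> F2 A2 -> P (A1 `&` A2) = (P A1 * P A2)%E.

Definition sigma_of (I : Type) (dT : measure_display) (T : measurableType dT)
    (D : set I) (X : I -> Omega -> T) : set (set Omega) :=
  <<s \bigcup_(i in D) g_sigma_algebra_preimage (X i) >>.

End independence.

Section rsqn.
Context (R : realType) (n d : nat).

Record AS1 (f : 'cV[R]_n -> R) (flow L : R) : Prop := {
  AS1_differentiable : forall x, differentiable f x ;
  AS1_continuous : continuous (gradient f) ;
  AS1_lower_bound : forall x, flow <= f x ;
  AS1_L_gt0 : 0 < L ;
  AS1_lipschitz : forall x y,
    enorm (gradient f x - gradient f y) <= L * enorm (x - y) }.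

(* [G x z] is relevant for [z] in [Xi] only. *)
Definition stochastic_oracle (Xi : set 'cV[R]_d)
    (G : 'cV[R]_n -> 'cV[R]_d -> 'cV[R]_n) : Prop :=
  measurable (Xi : set (borel_cV R d)) /\
  measurable_fun (setT `*` (Xi : set (borel_cV R d)))
    (fun p : borel_cV R n * borel_cV R d => G p.1 p.2 : borel_cV R n).

Context (dO : measure_display) (Omega : measurableType dO)
  (P : probability Omega R).

(* The random quantities of a run. Iterations and samples are numbered from 1
   as usual: only the indices 1 <= k <= N and 1 <= i <= batch k matter. *)
Record rsqn_run := RsqnRun {
  zeta : nat -> R ;
  xi : nat -> nat -> {RV P >-> borel_cV R d} ;
  rindex : {RV P >-> nat} ;
  iterate : nat -> {RV P >-> borel_cV R n} ;
  hess : nat -> Omega -> 'M[R]_n }.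

Implicit Types (run : rsqn_run) (batch : nat -> nat).

(* The indices of the samples xi_[k] = (xi_1, ..., xi_k). *)
Definition samples_upto batch (k : nat) : set (nat * nat) :=
  [set p | (1 <= p.1 <= k)%N /\ (1 <= p.2 <= batch p.1)%N].

Definition sigma_samples run batch (k : nat) : set (set Omega) :=
  sigma_of (samples_upto batch k) (fun p => xi run p.1 p.2).

Definition batch_gradient (G : 'cV[R]_n -> 'cV[R]_d -> 'cV[R]_n)
    run batch (k : nat) (w : Omega) : 'cV[R]_n :=
  (batch k)%:R^-1 *:
    \sum_(1 <= i < (batch k).+1) G (iterate run k w) (xi run k i w).

Definition inv_hess run (k : nat) (w : Omega) : 'M[R]_n :=
  invmx (hess run k w) + (zeta run k)%:M.

Record is_RSQN (Xi : set 'cV[R]_d) (G : 'cV[R]_n -> 'cV[R]_d -> 'cV[R]_n)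
    (x1 : 'cV[R]_n) (B1 : 'M[R]_n) (N : nat) (alpha : nat -> R) batch
    (PR : nat -> R) run : Prop := {
  rsqn_support : forall k i, (1 <= k <= N)%N -> (1 <= i <= batch k)%N ->
    P (xi run k i @^-1` Xi) = 1%E ;
  rsqn_batch : forall k, (1 <= k <= N)%N -> (1 <= batch k)%N ;
  rsqn_zeta : forall k, (1 <= k <= N)%N -> 0 < zeta run k ;
  rsqn_rindex_range : forall w, (1 <= rindex run w <= N)%N ;
  rsqn_rindex_pmf : forall k, (1 <= k <= N)%N ->
    P (rindex run @^-1` [set k]) = (PR k)%:E ;
  rsqn_rindex_indep : independent_systems P
    (g_sigma_algebra_preimage (rindex run)) (sigma_samples run batch N) ;
  rsqn_x1 : forall w, iterate run 1%N w = x1 ;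
  rsqn_B1 : forall w, hess run 1%N w = B1 ;
  rsqn_step : forall k w, (1 <= k <= N)%N ->
    iterate run k.+1 w = iterate run k w
      - alpha k *: (inv_hess run k w *m batch_gradient G run batch k w) ;
  rsqn_hess_spd : forall k w, (1 <= k <= N)%N -> spd (hess run k w) }.

(* The expectation over xi_{k,i} with x_k fixed is the integral against the
   law of xi_{k,i}, with x_k frozen at its value in the outcome [w]. *)
Record AS2 (f : 'cV[R]_n -> R) (Xi : set 'cV[R]_d)
    (G : 'cV[R]_n -> 'cV[R]_d -> 'cV[R]_n) (sigma : R) (N : nat)
    batch run : Prop := {
  AS2_independent : mutually_independent P (samples_upto batch N)
    (fun p => xi run p.1 p.2) ;
  AS2_unbiased : forall k i, (1 <= k <= N)%N -> (1 <= i <= batch k)%N ->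
    {ae P, forall w, forall j : 'I_n,
      (distribution P (xi run k i)).-integrable Xi
        (fun z => (G (iterate run k w) z j 0)%:E) /\
      (\int[distribution P (xi run k i)]_(z in Xi)
         (G (iterate run k w) z j 0)%:E =
       (gradient f (iterate run k w) j 0)%:E)%E} ;
  AS2_variance : forall k i, (1 <= k <= N)%N -> (1 <= i <= batch k)%N ->
    {ae P, forall w,
      (\int[distribution P (xi run k i)]_(z in Xi)
         (enorm (G (iterate run k w) z - gradient f (iterate run k w))
            ^+ 2)%:E <= (sigma ^+ 2)%:E)%E} }.

Definition AS3 (m M : R) (N : nat) run : Prop :=
  forall k, (1 <= k <= N)%N ->
    {ae P, forall w, loewner_le m%:M (inv_hess run k w) /\
                     loewner_le (inv_hess run k w) M%:M}.

Definition AS4 (N : nat) batch run : Prop :=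
  forall k, (2 <= k <= N)%N -> forall Y : set (borel_mx R n n),
    measurable Y -> sigma_samples run batch k.-1 (hess run k @^-1` Y).

Definition expected_sqr_grad (f : 'cV[R]_n -> R) run : \bar R :=
  ('E_P[fun w => (enorm (gradient f (iterate run (rindex run w) w)) ^+ 2)%R])%E.

Definition oracle_calls batch run (w : Omega) : nat :=
  (\sum_(1 <= k < (rindex run w).+1) batch k)%N.

End rsqn.

Section parameters.
Context (R : realType).
Implicit Types (L sigma m M Dt Df eps : R) (Nbar : nat).

Definition step_weight m M L (alpha : nat -> R) (k : nat) : R :=
  m * alpha k - L * M ^+ 2 * alpha k ^+ 2 / 2.

Definition PR_weighted m M L (alpha : nat -> R) (N : nat) (k : nat) : R :=
  step_weight m M L alpha k / \sum_(1 <= j < N.+1) step_weight m M L alpha j.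

Definition C1 L sigma m M Dt Df : R :=
  4 * sigma * M ^+ 2 * Df / (m ^+ 2 * Num.sqrt Dt) + sigma * L * Num.sqrt Dt.

Definition C2 L m M Df : R := 4 * L * M ^+ 2 * Df / m ^+ 2.

Definition sufficient_budget L sigma m M Dt Df eps Nbar : Prop :=
  (0 < Nbar)%N /\
  Num.max (C1 L sigma m M Dt Df ^+ 2 / eps ^+ 2 + 4 * C2 L m M Df / eps)
          (sigma ^+ 2 / (L ^+ 2 * Dt)) <= Nbar%:R.

(* The ceiling is an integer that is at least 1 when Nbar is positive, so that
   taking its absolute value is only a cast to nat. *)
Definition mbar L sigma Dt Nbar : nat :=
  absz (Num.ceil (Num.min Nbar%:R
      (Num.max 1 (sigma / L * Num.sqrt (Nbar%:R / Dt))))).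

End parameters.

(* Main.v *)
From HB Require Import structures.
From mathcomp Require Import ring lra.
From mathcomp Require Import measurable_realfun.
Require Import Defs.

Set Implicit Arguments.
Unset Strict Implicit.
Unset Printing Implicit Defensive.

Import Order.TTheory GRing.Theory Num.Theory.
Import numFieldNormedType.Exports.

Local Open Scope classical_set_scope.
Local Open Scope ring_scope.

(** Write H_k for B_k^-1 + zeta_k I, g_k for the gradient at x_k, e_k = G_k - g_k
    and s = m a - L M^2 a^2 / 2 for the step a.  The descent lemma along
    x_(k+1) = x_k - a H_k (g_k + e_k), with m I <= H_k <= M I, gives

      f(x_(k+1)) + s |g_k|^2 <= f(x_k) + <q_k, e_k> + (L a^2 M^2 / 2) |e_k|^2

    where q_k depends only on the samples drawn before iteration k.  Taking
    expectations kills the linear term, and |e_k|^2 has mean at most sigma^2 / m_k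
    because the samples of a batch are orthogonal.  Summing over k bounds the
    average of E |g_k|^2, which is E |grad f(x_R)|^2 since R is independent of the
    samples.  Conditional expectations are never formed: integrating a function of
    the past and of a fresh sample is Fubini's theorem on the product of the past
    sigma-algebra with the law of the sample.  The batch size balances the two
    terms of the resulting bound at the order of Nbar^(-1/2). *)

(** * Euclidean inner product, Cauchy-Schwarz and the Loewner order *)

Section euclidean.
Context (R : realType) (n : nat).
Implicit Types (u v w : 'cV[R]_n) (A B H : 'M[R]_n).

Definition dotv u v : R := (u^T *m v) 0 0.

Lemma dotvE u v : dotv u v = \sum_i u i 0 * v i 0.
Proof. by rewrite /dotv mxE; apply: eq_bigr => i _; rewrite mxE. Qed.

Lemma dotvC u v : dotv u v = dotv v u.
Proof. by rewrite !dotvE; apply: eq_bigr => i _; rewrite mulrC. Qed.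

Lemma dotvDl u v w : dotv (u + v) w = dotv u w + dotv v w.
Proof. by rewrite /dotv linearD mulmxDl mxE. Qed.

Lemma dotvZl (a : R) u v : dotv (a *: u) v = a * dotv u v.
Proof. by rewrite /dotv linearZ -scalemxAl mxE. Qed.

Lemma dotvDr u v w : dotv w (u + v) = dotv w u + dotv w v.
Proof. by rewrite dotvC dotvDl dotvC (dotvC v). Qed.

Lemma dotvZr (a : R) u v : dotv u (a *: v) = a * dotv u v.
Proof. by rewrite dotvC dotvZl dotvC. Qed.

Lemma dotvNl u v : dotv (- u) v = - dotv u v.
Proof. by rewrite -scaleN1r dotvZl mulN1r. Qed.

Lemma dotvNr u v : dotv u (- v) = - dotv u v.
Proof. by rewrite -scaleN1r dotvZr mulN1r. Qed.

Lemma dotv_ge0 u : 0 <= dotv u u.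
Proof. by rewrite dotvE sumr_ge0 // => i _; rewrite -expr2 sqr_ge0. Qed.

Lemma sqr_enorm u : enorm u ^+ 2 = dotv u u.
Proof.
rewrite /enorm sqr_sqrtr ?sumr_ge0// => [|i _]; last exact: sqr_ge0.
by rewrite dotvE; apply: eq_bigr => i _; rewrite expr2.
Qed.

Lemma enorm_ge0 u : 0 <= enorm u.
Proof. exact: sqrtr_ge0. Qed.

Lemma enormZ (a : R) u : enorm (a *: u) = `|a| * enorm u.
Proof.
apply: (@pexpIrn _ 2) => //; rewrite ?nnegrE ?mulr_ge0 ?enorm_ge0//.
by rewrite exprMn real_normK ?num_real// !sqr_enorm dotvZl dotvZr mulrA expr2.
Qed.

Lemma dotv_sqr_le u v : dotv u v ^+ 2 <= dotv u u * dotv v v.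
Proof.
have [v0|v0] := eqVneq (dotv v v) 0.
  have vE i : v i 0 = 0.
    move/eqP: v0; rewrite dotvE psumr_eq0 => [/allP/(_ i)|j _]; last first.
      by rewrite -expr2 sqr_ge0.
    by rewrite mem_index_enum mulf_eq0 orbb => /(_ isT) /eqP.
  rewrite v0 mulr0 [dotv u v]dotvE big1 ?expr0n// => i _.
  by rewrite vE mulr0.
have vgt0 : 0 < dotv v v by rewrite lt_neqAle eq_sym v0 dotv_ge0.
(* The squared norm of this vector is [dotv v v] times the Cauchy-Schwarz defect. *)
have := dotv_ge0 (dotv v v *: u - dotv u v *: v).
rewrite !(dotvDl, dotvDr, dotvNl, dotvNr, dotvZl, dotvZr) (dotvC v u) => h.
rewrite -subr_ge0 -(pmulr_rge0 _ vgt0); move: h.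
by congr (_ <= _); ring.
Qed.

Lemma dotv_le u v : dotv u v <= enorm u * enorm v.
Proof.
apply: le_trans (ler_norm _) _.
rewrite -ler_sqr ?nnegrE ?mulr_ge0 ?enorm_ge0//.
by rewrite real_normK ?num_real// exprMn !sqr_enorm dotv_sqr_le.
Qed.

Lemma symmetricmx_trP A : reflect (A = A^T) (A \is symmetricmx).
Proof.
by apply: (iffP (is_hermitianmxP _ _ _)); rewrite expr0 scale1r map_mx_id.
Qed.

Lemma symmetric_dotv H u v : H \is symmetricmx -> dotv u (H *m v) = dotv (H *m u) v.
Proof.
by move=> /symmetricmx_trP HH; rewrite /dotv trmx_mul -HH mulmxA.
Qed.

Lemma psdB_dotv A B v : psd (B - A) -> dotv v (A *m v) <= dotv v (B *m v).
Proof.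
move=> [_ /(_ v)]; rewrite -mulmxA mulmxBl mulmxBr mxE [X in _ + X]mxE.
by rewrite subr_ge0.
Qed.

Lemma loewner_dotv_ge (m : R) H v : loewner_le m%:M H ->
  m * dotv v v <= dotv v (H *m v).
Proof. by move=> /(psdB_dotv v); rewrite mul_scalar_mx dotvZr. Qed.

Lemma loewner_symmetric (a : R) H : loewner_le H a%:M -> H \is symmetricmx.
Proof.
move=> [/symmetricmx_trP + _]; rewrite linearB /= tr_scalar_mx => /eqP.
by rewrite (inj_eq (addrI _)) eqr_opp => /eqP HH; apply/symmetricmx_trP.
Qed.

(* Positivity of [H] at [v - M^-1 *: H *m v] gives [|H v|^2 <= M <v, H v>]. *)
Lemma loewner_sqr_mulmx_le (m M : R) H v : 0 < m -> 0 < M ->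
  loewner_le m%:M H -> loewner_le H M%:M ->
  dotv (H *m v) (H *m v) <= M ^+ 2 * dotv v v.
Proof.
move=> m0 M0 mH HM; have Hs := loewner_symmetric HM.
set z := H *m v.
have vz : dotv v z <= M * dotv v v.
  by rewrite -dotvZr -mul_scalar_mx; exact: psdB_dotv.
have zHz : dotv z (H *m z) <= M * dotv z z.
  by rewrite -dotvZr -mul_scalar_mx; exact: psdB_dotv.
have h0 : 0 <= dotv (v - M^-1 *: z) (H *m (v - M^-1 *: z)).
  apply: le_trans (loewner_dotv_ge _ mH).
  by rewrite mulr_ge0 ?dotv_ge0// ltW.
move: h0; rewrite mulmxBr -/z -scalemxAr !(dotvDl, dotvDr, dotvNl, dotvNr, dotvZl, dotvZr).
rewrite (symmetric_dotv v z Hs) -/z => h0.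
have {}h0 : 0 <= M * dotv v z - dotv z z.
  suff : 0 <= M^-1 * (M * dotv v z - dotv z z) by rewrite pmulr_rge0 ?invr_gt0.
  have h : M^-1 * (M^-1 * dotv z (H *m z)) <= M^-1 * dotv z z.
    by rewrite ler_pM2l ?invr_gt0// mulrC ler_pdivrMr// mulrC.
  by rewrite mulrBr mulKf ?gt_eqF//; lra.
have : M * dotv v z <= M ^+ 2 * dotv v v by rewrite expr2 -mulrA ler_pM2l.
lra.
Qed.

End euclidean.

(** * The descent inequality for a Lipschitz gradient *)

Section smooth_descent.
Context (R : realType) (n : nat).
Implicit Types (f : 'cV[R]_n -> R) (x v : 'cV[R]_n).

Lemma derive_gradient f x v : differentiable f x ->
  'D_v f x = dotv (gradient f x) v.
Proof.
move=> df; rewrite deriveE// dotvE [in LHS](matrix_sum_delta v).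
rewrite linear_sum; apply: eq_bigr => i _.
by rewrite big_ord1 linearZ /= mxE mulrC deriveE.
Qed.

Lemma derive_along_line f x v (t : R) : differentiable f (x + t *: v) ->
  is_derive t 1 (fun s : R => f (x + s *: v)) (dotv (gradient f (x + t *: v)) v).
Proof.
move=> df.
(* The difference quotient along the line at [t] is the one of [f] at [x + t *: v] in the direction
   [v]. *)
have E : (fun h : R => h^-1 *: (((fun s => f (x + s *: v)) \o shift t) (h *: 1)
      - f (x + t *: v))) =
    (fun h => h^-1 *: ((f \o shift (x + t *: v)) (h *: v) - f (x + t *: v))).
  apply/funext => h /=; congr (_ *: (f _ - _)).
  by rewrite [h *: 1]mulr1 scalerDl addrCA.
have dfv : derivable f (x + t *: v) v by exact: diff_derivable.
apply: DeriveDef; first by rewrite /derivable E.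
by rewrite /derive E -derive_gradient.
Qed.

Section lipschitz.
Context (f : 'cV[R]_n -> R) (flow L : R).
Hypothesis smooth : AS1 f flow L.

(** Subtracting from [f (x + t *: v)] the linear and quadratic terms of the bound leaves a function
    of [t] whose derivative is nonpositive inside the unit interval, by Cauchy-Schwarz and the
    Lipschitz bound; the mean value theorem concludes. *)
Lemma AS1_descent x v :
  f (x + v) <= f x + dotv (gradient f x) v + L / 2 * dotv v v.
Proof.
have df := AS1_differentiable smooth.
pose psi (t : R) := f (x + t *: v) - t * dotv (gradient f x) v
   - L / 2 * dotv v v * t ^+ 2.
pose dpsi (t : R) := dotv (gradient f (x + t *: v)) v - dotv (gradient f x) v
   - L * dotv v v * t.
have dpsiE (t : R) : is_derive t 1 psi (dpsi t).
  have h1 := derive_along_line (df (x + t *: v)).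
  rewrite /psi.
  apply: is_derive_eq.
  change (dotv (gradient f (x + t *: v)) v - (t * 0 + dotv (gradient f x) v * 1) -
    (L / 2 * dotv v v) * (t * 1 + t * 1) = dpsi t).
  by rewrite /dpsi; field.
have [c /andP[c0 c1] e] : exists2 c, c \in `]0, 1[%R & psi 1 - psi 0 = dpsi c * (1 - 0).
  apply: MVT => // t.
  apply: continuous_subspaceT => s.
  apply: differentiable_continuous; apply/derivable1_diffP.
  exact: (@ex_derive _ _ _ _ _ _ _ (dpsiE s)).
rewrite !bnd_simp in c0 c1.
have dc : dpsi c <= 0.
  rewrite /dpsi -dotvNl -dotvDl subr_le0.
  apply: le_trans (dotv_le _ _) _.
  have := AS1_lipschitz smooth (x + c *: v) x.
  have -> : x + c *: v - x = c *: v by rewrite addrC addKr.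
  rewrite enormZ gtr0_norm// => h.
  apply: le_trans (ler_wpM2r (enorm_ge0 _) h) _.
  by rewrite -sqr_enorm le_eqVlt; apply/orP; left; apply/eqP; ring.
move: e; rewrite /psi scale1r scale0r addr0 subr0 mulr1 !(mul1r, mul0r) subr0.
rewrite !(expr1n, expr0n) /= !(mulr0, mulr1) subr0; lra.
Qed.

(* Apply the descent inequality at the minimizer of its right-hand side. *)
Lemma AS1_sqr_gradient_le x :
  dotv (gradient f x) (gradient f x) <= 2 * L * (f x - flow).
Proof.
have L0 := AS1_L_gt0 smooth.
have := AS1_descent x (- L^-1 *: gradient f x).
rewrite !(dotvZl, dotvZr).
have := AS1_lower_bound smooth (x + - L^-1 *: gradient f x).
set g2 := dotv _ _; set y := f _ => h1 h2.
have h3 : flow <= f x - (2 * L)^-1 * g2.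
  apply: (le_trans h1); apply: (le_trans h2).
  by rewrite le_eqVlt; apply/orP; left; apply/eqP; field; rewrite gt_eqF.
have h4 : (2 * L)^-1 * g2 <= f x - flow by lra.
by rewrite -ler_pdivrMl// mulr_gt0.
Qed.

End lipschitz.
End smooth_descent.

(** * One quasi-Newton step, outcome by outcome *)

Section quasi_newton_step.
Context (R : realType) (n : nat) (f : 'cV[R]_n -> R) (flow L m M : R).
Hypotheses (smooth : AS1 f flow L) (m0 : 0 < m) (M0 : 0 < M).
Context (H : 'M[R]_n) (a : R).
Hypotheses (mH : loewner_le m%:M H) (HM : loewner_le H M%:M) (a0 : 0 <= a).

(** The vector q_k of the overview. The term in [H] comes from the first-order part of the descent
    inequality, the other from the cross term of |g + e|^2 once |H (g + e)|^2 is bounded by M^2 |g +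
    e|^2. *)
Definition noise_coefficient (x : 'cV[R]_n) : 'cV[R]_n :=
  (L * a ^+ 2 * M ^+ 2) *: gradient f x - a *: (H *m gradient f x).

Lemma quasi_newton_descent (x e : 'cV[R]_n) :
  f (x - a *: (H *m (gradient f x + e))) +
    (m * a - L * M ^+ 2 * a ^+ 2 / 2) * dotv (gradient f x) (gradient f x) <=
  f x + (dotv (noise_coefficient x) e + L * a ^+ 2 * M ^+ 2 / 2 * dotv e e).
Proof.
have L0 := AS1_L_gt0 smooth; set g := gradient f x; set v := H *m (g + e).
have h1 := AS1_descent smooth x (- (a *: v)).
have h2 : dotv v v <= M ^+ 2 * dotv (g + e) (g + e).
  exact: loewner_sqr_mulmx_le mH HM.
have h3 := loewner_dotv_ge g mH.
have h4 : dotv g v = dotv g (H *m g) + dotv (H *m g) e.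
  by rewrite /v mulmxDr dotvDr (symmetric_dotv g e (loewner_symmetric HM)).
move: h1; rewrite -/g !(dotvNl, dotvNr, dotvZl, dotvZr) ?opprK h4 => h1.
rewrite /noise_coefficient -/g !(dotvDl, dotvNl, dotvZl).
move: h2; rewrite !(dotvDl, dotvDr) (dotvC e g) => h2.
have h5 : L / 2 * (a * (a * dotv v v)) <=
    L / 2 * (a * (a * (M ^+ 2 * (dotv g g + dotv g e + (dotv g e + dotv e e))))).
  by rewrite ler_wpM2l ?divr_ge0 ?(ltW L0)// ler_wpM2l// ler_wpM2l.
have h6 : a * (m * dotv g g) <= a * dotv g (H *m g) by rewrite ler_wpM2l.
apply: le_trans (_ : f x - a * (dotv g (H *m g) + dotv (H *m g) e) +
   L / 2 * (a * (a * dotv v v)) + (m * a - L * M ^+ 2 * a ^+ 2 / 2) * dotv g g <= _).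
  by rewrite lerD2r; move: h1; rewrite !mulrN opprK.
nra.
Qed.

(** Both |g|^2 and |H g|^2 are controlled by the gap [f x - flow], so the linear noise term becomes
    integrable once the expected gap is finite. *)
Lemma noise_coefficient_sqr_le (x : 'cV[R]_n) (j : 'I_n) :
  noise_coefficient x j 0 ^+ 2 <=
    (2 * (L * a ^+ 2 * M ^+ 2) ^+ 2 + 2 * a ^+ 2 * M ^+ 2) * (2 * L * (f x - flow)).
Proof.
set g := gradient f x.
have gg := AS1_sqr_gradient_le smooth x; rewrite -/g in gg.
have coord (v : 'cV[R]_n) : v j 0 ^+ 2 <= dotv v v.
  rewrite dotvE (bigD1 j)//= expr2 lerDl sumr_ge0// => i _.
  by rewrite -expr2 sqr_ge0.
have h1 := coord g; have h2 := coord (H *m g).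
have h3 : dotv (H *m g) (H *m g) <= M ^+ 2 * dotv g g.
  exact: loewner_sqr_mulmx_le mH HM.
rewrite /noise_coefficient -/g mxE [X in X + _]mxE [X in _ + X]mxE [X in - X]mxE.
set p := L * a ^+ 2 * M ^+ 2; set u := g j 0; set v := (H *m g) j 0.
have h2' : v ^+ 2 <= M ^+ 2 * dotv g g.
  exact: le_trans h2 h3.
apply: le_trans (_ : 2 * (p ^+ 2 * u ^+ 2) + 2 * (a ^+ 2 * v ^+ 2) <= _).
  by have := sqr_ge0 (p * u + a * v); nra.
have h5 : p ^+ 2 * u ^+ 2 <= p ^+ 2 * (2 * L * (f x - flow)).
  by rewrite ler_wpM2l ?sqr_ge0// (le_trans h1).
have h6 : a ^+ 2 * v ^+ 2 <= a ^+ 2 * (M ^+ 2 * (2 * L * (f x - flow))).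
  rewrite ler_wpM2l ?sqr_ge0// (le_trans h2')//.
  by rewrite ler_wpM2l ?sqr_ge0.
nra.
Qed.

End quasi_newton_step.

(** * The budget inequality and the choice of batch size *)

Section parameters.
Context (R : realType) (L sigma m M Dt Df eps : R) (Nbar : nat).
Hypotheses (L0 : 0 < L) (s0 : 0 < sigma) (m0 : 0 < m) (M0 : 0 < M)
  (Dt0 : 0 < Dt) (Df0 : 0 <= Df) (e0 : 0 < eps).
Hypothesis budget : sufficient_budget L sigma m M Dt Df eps Nbar.

Let s : R := sigma / L * Num.sqrt (Nbar%:R / Dt).

Let NbarR_gt0 : 0 < Nbar%:R :> R.
Proof. by have [N0 _] := budget; rewrite ltr0n. Qed.

Let s_gt0 : 0 < s.
Proof. by rewrite /s mulr_gt0 ?divr_gt0// sqrtr_gt0 divr_gt0. Qed.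

(** The second lower bound on the budget gives s^2 <= Nbar^2. Hence the minimum with [Nbar] in
    [mbar] is inactive. *)
Let s_le_Nbar : s <= Nbar%:R.
Proof.
have [_ /(le_trans _) -/(_ (sigma ^+ 2 / (L ^+ 2 * Dt)))] := budget.
rewrite le_max lexx orbT => /(_ isT) h.
rewrite -ler_sqr ?nnegrE ?(ltW s_gt0) ?(ltW NbarR_gt0)// /s exprMn.
rewrite sqr_sqrtr; last by rewrite divr_ge0// ltW.
have -> : (sigma / L) ^+ 2 * (Nbar%:R / Dt) = sigma ^+ 2 / (L ^+ 2 * Dt) * Nbar%:R.
  by field; rewrite !gt_eqF.
by rewrite [X in _ <= X]expr2 ler_wpM2r// ltW.
Qed.

Let one_le_Nbar : 1 <= Nbar%:R :> R.
Proof. by have [N0 _] := budget; rewrite ler1n. Qed.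

Let mbarE : (mbar L sigma Dt Nbar)%:Z = Num.ceil (Num.max 1 s).
Proof.
rewrite /mbar -/s min_r; last by rewrite ge_max one_le_Nbar s_le_Nbar.
rewrite gez0_abs// ceil_ge0//.
by apply: (@lt_le_trans _ _ 1); rewrite ?le_max ?lexx// ltrN10.
Qed.

Let mbarRE : (mbar L sigma Dt Nbar)%:R = (Num.ceil (Num.max 1 s))%:~R :> R.
Proof. by rewrite -mbarE. Qed.

Lemma mbar_ge_max : Num.max 1 s <= (mbar L sigma Dt Nbar)%:R.
Proof. by rewrite mbarRE ceil_ge. Qed.

Lemma mbar_gt0 : (0 < mbar L sigma Dt Nbar)%N.
Proof.
by rewrite -(ler1n R) (le_trans _ mbar_ge_max)// le_max lexx.
Qed.

(** The ceiling cannot overshoot, because [Nbar] is an integer. *)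
Lemma mbar_le_budget : (mbar L sigma Dt Nbar <= Nbar)%N.
Proof.
rewrite -lez_nat mbarE ceil_le_int -pmulrn.
by rewrite ge_max one_le_Nbar s_le_Nbar.
Qed.

Lemma mbar_le1D : (mbar L sigma Dt Nbar)%:R <= 1 + s.
Proof.
rewrite mbarRE; have := s_gt0.
have [s1|s1] := leP 1 s.
  have : (Num.ceil s)%:~R < s + 1 by have := ceilB1_lt s; rewrite intrB; lra.
  lra.
rewrite ceil1; lra.
Qed.

Lemma iterations_gt0 : (0 < Nbar %/ mbar L sigma Dt Nbar)%N.
Proof. by rewrite divn_gt0 ?mbar_gt0// mbar_le_budget. Qed.

(** Rounding the number of iterations down costs a factor 2, and rounding the batch size up replaces
    s by at most 1 + s. With t the square root of [Nbar], it remains to see that (c2 + c1 t) / t^2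
    <= eps, a quadratic inequality in t that follows from the first lower bound on the budget. *)
Lemma sufficient_budget_bound :
  2 * L * M ^+ 2 * Df / (m ^+ 2 * (Nbar %/ mbar L sigma Dt Nbar)%:R)
    + sigma ^+ 2 / (mbar L sigma Dt Nbar)%:R <= eps.
Proof.
set mb := mbar L sigma Dt Nbar.
have mb0 : 0 < mb%:R :> R by rewrite ltr0n mbar_gt0.
have N0 : 0 < (Nbar %/ mb)%:R :> R by rewrite ltr0n iterations_gt0.
set t := Num.sqrt (Nbar%:R : R).
have t0 : 0 < t by rewrite sqrtr_gt0.
have tt : t ^+ 2 = Nbar%:R by rewrite sqr_sqrtr// ltW.
set r := Num.sqrt Dt.
have r0 : 0 < r by rewrite sqrtr_gt0.
have rr : r ^+ 2 = Dt by rewrite sqr_sqrtr// ltW.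
have sE : s = sigma / L * (t / r).
  by rewrite /s sqrtrM ?ltW// sqrtrV// ltW.
set c2 := C2 L m M Df; set c1 := C1 L sigma m M Dt Df.
have c2_0 : 0 <= c2.
  by rewrite /c2 /C2; rewrite !(mulr_ge0, invr_ge0, exprn_ge0, ler0n)// ltW.
(* The two summands are the coefficients of 1/t in [c2 * s / Nbar] and in [sigma ^+ 2 / s]. *)
have c1E : c1 = c2 * (sigma / L / r) + sigma * L * r.
  rewrite /c1 /c2 /C1 /C2 -/r; field; rewrite !gt_eqF//.
have bound1 : 2 * L * M ^+ 2 * Df / (m ^+ 2 * (Nbar %/ mb)%:R) <= c2 * (mb%:R / Nbar%:R).
  (* The remainder of the division is below [mb], hence at most [Nbar %/ mb * mb] because the
     quotient is positive. *)
  have h : Nbar%:R <= 2 * mb%:R * (Nbar %/ mb)%:R :> R.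
    rewrite -!natrM ler_nat.
    have -> : (2 * mb * (Nbar %/ mb) = Nbar %/ mb * mb + Nbar %/ mb * mb)%N.
      by rewrite -mulnA mulnC muln2 addnn [(mb * _)%N]mulnC.
    rewrite {1}(divn_eq Nbar mb) leq_add2l.
    apply: leq_trans (ltnW (ltn_pmod _ mbar_gt0)) _.
    by rewrite leq_pmull// iterations_gt0.
  have -> : 2 * L * M ^+ 2 * Df / (m ^+ 2 * (Nbar %/ mb)%:R) =
            c2 * (2^-1 * (Nbar %/ mb)%:R^-1).
    rewrite /c2 /C2; field; rewrite !gt_eqF//.
  apply: ler_wpM2l => //.
  rewrite ler_pdivlMr// -invfM mulrC ler_pdivrMr ?mulr_gt0//.
  by apply: le_trans h _; rewrite mulrAC mulrC mulrA.
have bound2 : sigma ^+ 2 / mb%:R <= sigma * L * r / t.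
  have -> : sigma * L * r / t = sigma ^+ 2 / s.
    by rewrite sE; field; rewrite !gt_eqF.
  apply: ler_wpM2l; first exact: sqr_ge0.
  rewrite lef_pV2 ?posrE//.
  by rewrite (le_trans _ mbar_ge_max)// le_max lexx orbT.
have bound3 : c2 * (mb%:R / Nbar%:R) <= c2 * ((1 + s) / Nbar%:R).
  by rewrite ler_wpM2l// ler_pM2r ?invr_gt0// mbar_le1D.
suff : c2 * ((1 + s) / Nbar%:R) + sigma * L * r / t <= eps by lra.
have -> : c2 * ((1 + s) / Nbar%:R) + sigma * L * r / t = (c2 + c1 * t) / t ^+ 2.
  by rewrite c1E sE -tt; field; rewrite !gt_eqF.
rewrite ler_pdivrMr ?exprn_gt0//.
have hN : c1 ^+ 2 + 4 * c2 * eps <= (eps * t) ^+ 2.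
  have [_ /(le_trans _) -/(_ (c1 ^+ 2 / eps ^+ 2 + 4 * c2 / eps))] := budget.
  rewrite le_max lexx => /(_ isT); rewrite -tt exprMn => h.
  rewrite -ler_pdivrMl ?exprn_gt0//; move: h; congr (_ <= _); field.
  by rewrite gt_eqF.
have c1_0 : 0 <= c1.
  by rewrite c1E addr_ge0//; rewrite !(mulr_ge0, invr_ge0)// ltW.
set y := eps * t in hN *.
have y0 : 0 < y by rewrite mulr_gt0.
have c2e : 0 <= c2 * eps by rewrite mulr_ge0// ltW.
have c1y : c1 <= y by rewrite -ler_sqr ?nnegrE ?(ltW y0)//; lra.
(* Since c2 eps <= (y^2 - c1^2) / 4, the right side exceeds the left by at least (3 y - c1) (y - c1)
   / 4. *)
have key : c1 * y + c2 * eps <= y ^+ 2 by nra.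
rewrite -(ler_pM2l e0).
have -> : eps * (eps * t ^+ 2) = y ^+ 2 by rewrite /y; ring.
by apply: le_trans key; rewrite /y le_eqVlt; apply/orP; left; apply/eqP; ring.
Qed.

End parameters.

(** * Borel measurability of matrix-valued maps, entry by entry *)

Section borel_matrix.
Context (R : realType).

Lemma measurable_inv : measurable_fun [set: R] (@GRing.inv R).
Proof.
(* [powR] is the inverse at exponent -1 on nonnegative numbers only *)
have E : @GRing.inv R = (fun x => x * (x ^+ 2) `^ (-1)).
  apply/funext => x; rewrite powR_inv1 ?sqr_ge0//.
  have [->|x0] := eqVneq x 0; first by rewrite invr0 mul0r.
  by rewrite expr2 invfM mulrA mulfV// mul1r.
rewrite E; apply: measurable_funM => //.
apply: (measurableT_comp (@measurable_powR R (-1))).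
exact: exprn_measurable.
Qed.

Section dims.
Context (p q : nat).

Lemma continuous_borel_measurable (h : 'M[R]_(p, q) -> R) : continuous h ->
  measurable_fun setT (h : borel_mx R p q -> R).
Proof.
move=> ch.
apply: (measurability _ (RGenOInfty.measurableE R)) => /= _ [_ [x ->] <-].
rewrite setTI; apply: sub_sigma_algebra.
by apply: open_comp => [M _|]; [exact: ch|exact: rray_open].
Qed.

Lemma measurable_coord (i : 'I_p) (j : 'I_q) :
  measurable_fun setT ((fun M => M i j) : borel_mx R p q -> R).
Proof. by apply: continuous_borel_measurable; exact: coord_continuous. Qed.

(* An open set is the union of the countably many rational cubes it contains. *)
Lemma measurable_fun_coordP d (T : measurableType d) (D : set T)
    (F : T -> borel_mx R p q) :
  (forall i j, measurable_fun D (fun t => F t i j)) -> measurable_fun D F.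
Proof.
move=> mF mD; suff : measurable_fun D F by exact.
have := (@measurability _ _ T (borel_mx R p q) D F (@open 'M[R]_(p, q)) erefl); apply.
move=> /= _ [U oU <-].
pose cube (c : 'M[rat]_(p, q) * rat) : set 'M[R]_(p, q) :=
  ball (map_mx ratr c.1 : 'M[R]_(p, q)) (ratr c.2).
have UE : U = \bigcup_(c in [set c | 0 < c.2 /\ cube c `<=` U]) cube c.
  apply/seteqP; split => [M UM|M [c [_ cU] cM]]; last exact: cU.
  have [e /= e0 eU] := (iffLR (nbhs_ballP _ _)) (open_nbhs_nbhs (conj oU UM)).
  (* A radius below e / 2 keeps a cube containing [M] inside the ball of radius e around [M]. *)
  have [r /andP[r0 re]] : exists r : rat, 0 < (ratr r : R) < e / 2.
    have /(_ (ltac:(by rewrite divr_gt0)) ) := @rat_in_itvoo R 0 (e / 2).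
    by move=> [r]; rewrite in_itv/=; exists r.
  have {}r0 : 0 < r by rewrite -(ltr0q R).
  have [c cM] : exists c : 'M[rat]_(p, q), forall i j,
      `|ratr (c i j) - M i j| < (ratr r : R).
    have h i j : {c : rat | `|ratr c - M i j| < (ratr r : R)}.
      apply: cid.
      have /(_ _) := @rat_in_itvoo R (M i j - ratr r) (M i j + ratr r).
      have r0' : 0 < (ratr r : R) by rewrite ltr0q.
      case => [|c]; first lra.
      rewrite in_itv/= => /andP[c1 c2]; exists c.
      by rewrite ltr_norml; apply/andP; split; lra.
    by exists (\matrix_(i, j) sval (h i j)) => i j; rewrite mxE; case: (h i j).
  have cMb : cube (c, r) M.
    split; first by rewrite ltr0q.
    by move=> i j; rewrite mxE; exact: cM.
  exists (c, r) => //; split => //= M' cM'; apply: eU.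
  rewrite [e]splitr; apply: (@ball_triangle _ _ (map_mx ratr c : 'M[R]_(p, q))).
    by apply: ball_sym; apply: le_ball cMb; exact: ltW.
  by apply: le_ball cM'; exact: ltW.
rewrite UE preimage_bigcup setI_bigcupr.
rewrite bigcup_mkcond; apply: countable_bigcupT_measurable => [|c]; first exact: countableP.
case: ifPn => [/set_mem[c0 _]|_] //.
(* The intersection starts from [D] and not from [setT], so that the equality also holds for
   matrices without entries. *)
have -> : D `&` F @^-1` cube c =
    \big[setI/D]_(i : 'I_p * 'I_q)
      (D `&` (fun t => F t i.1 i.2) @^-1` ball (ratr (c.1 i.1 i.2) : R) (ratr c.2)).
  apply/seteqP; split => t.
    move=> [Dt [_ h]]; elim/big_ind : _ => // -[i j] _.
    by split => //=; have := h i j; rewrite mxE.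
  move=> h; have Dt : D t.
    move: h; elim/big_ind : _ => // [A B hA hB [] /hA //|i _ []//].
  split => //; split; first by rewrite ltr0q.
  move=> i j; rewrite mxE.
  move: h; rewrite (bigD1 (i, j))//= => -[[]].
  done.
apply: big_ind => // [A B|i _]; first exact: measurableI.
by apply: mF => //; exact: measurable_ball.
Qed.

End dims.

Section operations.
Context d (T : measurableType d) (D : set T).

Lemma measurable_coord_comp p q (F : T -> borel_mx R p q) i j :
  measurable_fun D F -> measurable_fun D (fun t => F t i j).
Proof.
by move=> mF; apply: (measurable_comp _ _ (@measurable_coord p q i j)).
Qed.

Lemma measurable_mulmx p q r (F : T -> 'M[R]_(p, q)) (H : T -> 'M[R]_(q, r)) i j :
  (forall i j, measurable_fun D (fun t => F t i j)) ->
  (forall i j, measurable_fun D (fun t => H t i j)) ->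
  measurable_fun D (fun t => (F t *m H t) i j).
Proof.
move=> mF mH; under eq_fun do rewrite mxE.
by apply: measurable_sum => k; exact: measurable_funM.
Qed.

Lemma measurable_det n (F : T -> 'M[R]_n) :
  (forall i j, measurable_fun D (fun t => F t i j)) ->
  measurable_fun D (fun t => \det (F t)).
Proof.
move=> mF; rewrite /determinant; apply: measurable_sum => s.
by apply: measurable_funM => //; apply: measurable_prod => i _; exact: mF.
Qed.

(** On invertible matrices the inverse is the adjugate over the determinant, both polynomial in the
    entries. *)
Lemma measurable_invmx n (F : T -> 'M[R]_n) i j :
  (forall t, F t \in unitmx) ->
  (forall i j, measurable_fun D (fun t => F t i j)) ->
  measurable_fun D (fun t => invmx (F t) i j).
Proof.
move=> uF mF; under eq_fun => t do rewrite /invmx uF mxE mxE.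
apply: measurable_funM.
  apply: measurable_comp measurable_inv _ => //; exact: measurable_det.
rewrite /cofactor; apply: measurable_funM => //; apply: measurable_det => k l.
by under eq_fun do rewrite !mxE; exact: mF.
Qed.

End operations.
End borel_matrix.

(** A nonzero vector of the left kernel would be a zero of the quadratic form. *)
Lemma spd_unitmx (R : realType) n (A : 'M[R]_n) : spd A -> A \in unitmx.
Proof.
move=> [_ pA]; rewrite -row_free_unit; apply: inj_row_free => v vA.
apply: contrapT => /eqP v0.
have := pA v^T; rewrite trmxK -(inj_eq trmx_inj) trmxK trmx0 => /(_ v0).
by rewrite vA mul0mx mxE ltxx.
Qed.

(** * Independence of a fresh sample from the sigma-algebra of other samples *)

Section independence_of_sigma_algebras.
Context (R : realType) (dO : measure_display) (Omega : measurableType dO)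
  (P : probability Omega R).
Context (I : choiceType) (dT : measure_display) (T : measurableType dT).
Context (X : I -> Omega -> T).

Let mpreim i B : measurable_fun setT (X i) -> measurable B -> measurable (X i @^-1` B).
Proof. by move=> mX mB; rewrite -[_ @^-1` _]setTI; exact: mX. Qed.

Lemma sigma_of_measurable (D : set I) : (forall i, measurable_fun setT (X i)) ->
  sigma_of D X `<=` measurable.
Proof.
move=> mX; apply: smallest_sub; first exact: sigma_algebra_measurable.
by move=> A [i Di [B mB <-]]; exact: mX.
Qed.

(** A pi-lambda argument. With E the event on sample [j], the finite measures sending A to P(A and
    E) and to P(A) P(E) agree on finite intersections of single-sample events from [D1], a pi-system
    that generates [sigma_of D1 X]. *)
Lemma mutually_independent_sigma_of (D D1 : set I) (j : I) :
  (forall i, measurable_fun setT (X i)) ->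
  mutually_independent P D X -> D1 `<=` D -> D j -> ~ D1 j ->
  forall A B, sigma_of D1 X A -> measurable B ->
    P (A `&` X j @^-1` B) = (P A * P (X j @^-1` B))%E.
Proof.
move=> mX indep D1D Dj D1j A B sA mB.
pose Pi : set (set Omega) := [set A | exists (J : {fset I}) (C : I -> set T),
  [/\ [set` J] `<=` D1, forall i, measurable (C i) &
      A = \bigcap_(i in [set` J]) (X i @^-1` C i)]].
have Pim : Pi `<=` measurable.
  move=> _ [J [C [_ mC ->]]]; apply: fin_bigcap_measurable => // i _.
  exact: mpreim.
have PiI : setI_closed Pi.
  move=> _ _ [J1 [C1 [J1D mC1 ->]]] [J2 [C2 [J2D mC2 ->]]].
  (* An index outside one of the two sets is unconstrained there, hence the value [setT]. *)
  exists (J1 `|` J2)%fset.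
  exists (fun i => (if i \in J1 then C1 i else setT) `&`
                   (if i \in J2 then C2 i else setT)); split.
  - by move=> i /=; rewrite in_fsetU => /orP[/J1D|/J2D].
  - by move=> i; apply: measurableI; case: ifP.
  - apply/seteqP; split => w /=.
      move=> [w1 w2] i /=; rewrite in_fsetU => _.
      by split; case: ifPn => // iJ; [exact: w1|exact: w2].
    move=> h; split => i /= iJ; have := h i; rewrite /= in_fsetU iJ ?orbT;
      by move=> /(_ isT)[].
have PiT : Pi setT.
  exists fset0, (fun=> setT); split => //; apply/seteqP; split => //.
have mE : measurable (X j @^-1` B) by exact: mpreim.
have PE : (0 <= fine (P (X j @^-1` B)))%R by exact: fine_ge0.
pose m2 := mscale (NngNum PE) P.
have m2E C : m2 C = (P C * P (X j @^-1` B))%E.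
  rewrite muleC; transitivity ((fine (P (X j @^-1` B)))%:E * P C)%E => //.
  by rewrite fineK// fin_num_measure.
rewrite -m2E -[LHS]/(mrestr P mE A).
apply: (@g_sigma_algebra_measure_unique _ R Omega Pi Pim (fun=> setT)) => //.
- by apply/seteqP; split => // w _; exists 0%N.
- move=> _ [J [C [JD mC ->]]].
  apply: etrans (esym (m2E _)); rewrite /mrestr.
  have jJ : j \notin J by apply/negP => /JD.
  have neqj i : i \in J -> (i == j) = false.
    by move=> iJ; apply/negbTE; apply: contraNneq jJ => <-.
  (* Independence is applied to [J] and to [J] with [j] added; comparing the two product formulas
     gives the claim. *)
  have JjD : [set` (j |` J)%fset] `<=` D.
    by move=> i /=; rewrite in_fset1U => /orP[/eqP->//|/JD/D1D].
  have mC' i : i \in (j |` J)%fset -> measurable (if i == j then B else C i).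
    by case: ifP.
  have := indep _ _ JjD mC'.
  rewrite big_fsetU1//= eqxx.
  have := indep J C (subset_trans JD D1D) (fun i _ => mC i).
  move=> ->; under eq_big_seq => i iJ do rewrite neqj//.
  rewrite muleC => <-; congr (P _); apply/seteqP; split => w /=.
    move=> [wJ wj] i /=; rewrite in_fset1U; case: eqVneq => [->//|_ /= iJ].
    exact: wJ.
  move=> h; split => [i /= iJ|]; last first.
    by have := h j; rewrite /= in_fset1U eqxx; exact.
  by have := h i; rewrite /= in_fset1U iJ orbT neqj//; exact.
- move=> _; rewrite -[X in (X < _)%E]/(P (setT `&` X j @^-1` B)) setTI.
  by rewrite (le_lt_trans (probability_le1 _ _))// ltry.
- move: sA; apply: smallest_sub; first exact: smallest_sigma_algebra.
  move=> _ [i D1i [C mC <-]]; apply: sub_sigma_algebra.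
  exists [fset i]%fset, (fun=> C); split => //.
    by move=> k /=; rewrite in_fset1 => /eqP->.
  apply/seteqP; split => w /=; first by move=> [_ wC] k /=; rewrite in_fset1 => /eqP->.
  by move=> h; split => //; apply: h; rewrite /= in_fset1.
Qed.

End independence_of_sigma_algebras.

(** * Freezing the past: Fubini's theorem for a fresh variable *)

Section freezing.
Context (R : realType) (dO : measure_display) (Omega : measurableType dO)
  (P : probability Omega R) (dT : measure_display) (T : measurableType dT).
Context (F : set (set Omega)) (Y : {RV P >-> T}).
Hypothesis Fm : <<s F>> `<=` measurable.
Hypothesis FY : forall A B, <<s F>> A -> measurable B ->
  P (A `&` Y @^-1` B) = (P A * P (Y @^-1` B))%E.

Local Notation Omega' := (g_sigma_algebraType F).
Local Notation PY := (distribution P Y).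

Let id_measurable : measurable_fun setT (idfun : Omega -> Omega').
Proof. by move=> _ A mA; rewrite setTI; exact: Fm. Qed.

Let idY_measurable : measurable_fun setT ((fun w => (w, Y w)) : Omega -> Omega' * T).
Proof. by apply: measurable_fun_pair => //; exact: id_measurable. Qed.

Lemma restricted_measurable_fun d' (T' : measurableType d') (h : Omega -> T') :
  measurable_fun setT (h : Omega' -> T') -> measurable_fun setT h.
Proof. by move=> mh; exact: measurableT_comp mh id_measurable. Qed.

Lemma joint_measurable_fun d' (T' : measurableType d') (h : Omega' * T -> T') :
  measurable_fun setT h -> measurable_fun setT (fun w : Omega => h (w, Y w)).
Proof. by move=> mh; exact: measurableT_comp mh idY_measurable. Qed.

(** The identity as a map to the same space with the smaller sigma-algebra; its law is [P]
    restricted to the past. *)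
Let idm : {mfun Omega >-> Omega'} :=
  HB.pack (idfun : Omega -> Omega') (isMeasurableFun.Build _ _ _ _ _ id_measurable).
Let idYm : {mfun Omega >-> (Omega' * T)%type} :=
  HB.pack (fun w : Omega => (w, Y w) : Omega' * T)
    (isMeasurableFun.Build _ _ _ _ _ idY_measurable).

(** Independence gives agreement on measurable rectangles, which determine the product measure. *)
Let joint_law (X : set (Omega' * T)) : measurable X ->
  (distribution P idm \x PY)%E X = distribution P idYm X.
Proof. by apply: product_measure_unique => A B mA mB; rewrite -FY. Qed.

Local Open Scope ereal_scope.

Lemma freezing (phi : Omega' * T -> \bar R) : measurable_fun setT phi ->
  (forall x, 0 <= phi x) ->
  \int[P]_w phi (w, Y w) = \int[P]_w \int[PY]_z phi (w, z).
Proof.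
move=> mphi phi0.
transitivity (\int[distribution P idYm]_x phi x).
  by rewrite ge0_integral_pushforward.
transitivity (\int[distribution P idm \x PY]_x phi x).
  by apply: eq_measure_integral => A mA _; (exact: joint_law || exact/esym/joint_law).
rewrite fubini_tonelli1// ge0_integral_pushforward//.
- exact: measurable_fun_fubini_tonelli_F.
- by move=> w _; exact: integral_ge0.
Qed.

(** In the iterated integral [c] is constant for the inner integration over the fresh variable,
    where [u] has mean zero. Integrability of the product is what Fubini's theorem asks for signed
    functions. *)
Lemma freezing_orthogonal (c : Omega' -> R) (u : Omega' * T -> R) :
  measurable_fun setT c -> measurable_fun setT u ->
  {ae P, forall w : Omega, PY.-integrable setT (fun z => (u (w, z))%:E) /\
                   \int[PY]_z (u (w, z))%:E = 0} ->
  P.-integrable setT (fun w => (c w * u (w, Y w))%:E) ->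
  \int[P]_w (c w * u (w, Y w))%:E = 0.
Proof.
move=> mc mu u0 icu.
pose f (x : Omega' * T) := (c x.1 * u x)%:E.
have mf : measurable_fun setT f.
  apply/measurable_EFinP; apply: measurable_funM => //.
  exact: measurableT_comp mc measurable_fst.
have fi : (distribution P idYm).-integrable setT f.
  exact: integrable_pushforward.
have fi' : (distribution P idm \x PY).-integrable setT f.
  apply/integrableP; split => //.
  rewrite (_ : integral _ _ _ = \int[distribution P idYm]_x `|f x|).
    by have /integrableP[] := fi.
  by apply: eq_measure_integral => A mA _; (exact: joint_law || exact/esym/joint_law).
transitivity (\int[distribution P idYm]_x f x).
  by rewrite integral_pushforward.
transitivity (\int[distribution P idm \x PY]_x f x).
  by apply: eq_measure_integral => A mA _; (exact: joint_law || exact/esym/joint_law).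
rewrite -integral12_prod_meas1//.
have mF := measurable_fubini_F fi'.
(* With an absolute value inside, the integrand is nonnegative and can be pulled back to [Omega],
   where the almost sure hypothesis on [u] lives. *)
apply/eqP; rewrite -abse_eq0 eq_le abse_ge0 andbT.
apply: le_trans (le_abse_integral _ _ _) _ => //.
rewrite ge0_integral_pushforward//; last exact: measurableT_comp.
rewrite preimage_setT; apply: (@le_trans _ _ (\int[P]_w 0)); last by rewrite integral0.
rewrite le_eqVlt; apply/orP; left; apply/eqP; apply: ge0_ae_eq_integral => //.
  exact/(restricted_measurable_fun (measurableT_comp _ mF)).
  by move=> w _; exact: abse_ge0.
move: u0; apply: filterS => w [iu u0] _ /=.
rewrite /fubini_F /f /=.
under eq_integral do rewrite EFinM.
by rewrite integralZl// u0 mule0 abse0.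
Qed.

End freezing.

(** * Sub-sigma-algebras generated by sets of samples *)

Section sub_sigma_algebras.
Context (Omega : pointedType) (dT : measure_display) (T : measurableType dT)
  (I : Type) (X : I -> Omega -> T).

(** The generators of [sigma_of] before closure, the form from which [g_sigma_algebraType] builds a
    measurable space. *)
Definition sigma_of_gen (D : set I) : set (set Omega) :=
  \bigcup_(i in D) g_sigma_algebra_preimage (X i).

Lemma sigma_of_gen_measurable_fun (D : set I) i : D i ->
  measurable_fun setT (X i : g_sigma_algebraType (sigma_of_gen D) -> T).
Proof.
move=> Di _ A mA; apply: sub_sigma_algebra; exists i => //.
by exists A.
Qed.

Lemma sigma_of_gen_sub d' (T' : measurableType d') (h : Omega -> T') (D D' : set I) :
  D `<=` D' ->
  measurable_fun setT (h : g_sigma_algebraType (sigma_of_gen D) -> T') ->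
  measurable_fun setT (h : g_sigma_algebraType (sigma_of_gen D') -> T').
Proof.
move=> DD' mh _ A mA; have := mh measurableT A mA.
apply: sub_smallest2r => [|B [i Di XB]]; first exact: smallest_sigma_algebra.
by exists i => //; exact: DD'.
Qed.

End sub_sigma_algebras.

(** * Centred oracle noise *)

Section noise.
Context (R : realType) (n d : nat) (f : 'cV[R]_n -> R)
  (Xi : set 'cV[R]_d) (G : 'cV[R]_n -> 'cV[R]_d -> 'cV[R]_n).

(** The oracle is known to be measurable over [Xi] only; the value 0 elsewhere makes the noise
    jointly measurable on the whole product and reduces its integrals to integrals over [Xi]. *)
Definition noise (x : 'cV[R]_n) (z : 'cV[R]_d) : 'cV[R]_n :=
  if z \in Xi then G x z - gradient f x else 0.

Lemma gradient_coord_measurable (a : 'I_n) : continuous (gradient f) ->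
  measurable_fun setT ((fun x => gradient f x a 0) : borel_cV R n -> R).
Proof.
move=> cg; apply: continuous_borel_measurable => x.
apply: (@continuous_comp _ _ _ (gradient f) (fun M : 'cV[R]_n => M a 0)); first exact: cg.
exact: coord_continuous.
Qed.

Lemma noise_measurable (a : 'I_n) : continuous (gradient f) ->
  stochastic_oracle Xi G ->
  measurable_fun setT
    (fun p : borel_cV R n * borel_cV R d => noise p.1 p.2 a 0).
Proof.
move=> cg [mXi mG].
pose D : set (borel_cV R n * borel_cV R d) := setT `*` Xi.
have mD : measurable D by exact: measurableX.
have E : (fun p : borel_cV R n * borel_cV R d => noise p.1 p.2 a 0) =
    (fun p => G p.1 p.2 a 0 - gradient f p.1 a 0) \_ D.
  apply/funext => p; rewrite /noise patchE.
  have -> : (p \in D) = (p.2 \in Xi).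
    by apply/idP/idP; rewrite !inE => //= -[].
  by case: ifP; rewrite ?mxE.
rewrite E; have [+ _] := measurable_restrictT (fun p : borel_cV R n * borel_cV R d =>
  G p.1 p.2 a 0 - gradient f p.1 a 0) mD; apply.
apply: (@measurable_funB _ _ _ D (fun p => G p.1 p.2 a 0) (fun p => gradient f p.1 a 0)).
  exact: measurable_coord_comp mG.
apply: measurable_funTS.
exact: measurableT_comp (gradient_coord_measurable a cg) measurable_fst.
Qed.

Context (mu : probability (borel_cV R d) R) (x : 'cV[R]_n).
Hypothesis mXi : measurable (Xi : set (borel_cV R d)).
Hypothesis Xi1 : mu Xi = 1%E.

Let noiseE (a : 'I_n) : (fun z : borel_cV R d => (noise x z a 0)%:E) =
  (fun z => (G x z a 0)%:E - (gradient f x a 0)%:E)%E \_ Xi.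
Proof. by apply/funext => z; rewrite /noise patchE; case: ifP; rewrite ?mxE. Qed.

Lemma noise_mean0 (a : 'I_n) :
  mu.-integrable Xi (fun z => (G x z a 0)%:E) ->
  (\int[mu]_(z in Xi) (G x z a 0)%:E = (gradient f x a 0)%:E)%E ->
  mu.-integrable setT (fun z => (noise x z a 0)%:E) /\
  (\int[mu]_z (noise x z a 0)%:E = 0)%E.
Proof.
move=> iG GE.
have ic : mu.-integrable Xi (fun=> (gradient f x a 0)%:E).
  by apply: finite_measure_integrable_cst.
split; first by rewrite noiseE; apply/(integrable_mkcond _ mXi).1; exact: integrableB.
rewrite noiseE -integral_mkcond integralB// GE integral_cst//.
by rewrite [X in (_ * X)%E](_ : _ = 1%E) ?mule1 ?subee.
Qed.

Lemma noise_second_moment :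
  (\int[mu]_z (dotv (noise x z) (noise x z))%:E =
   \int[mu]_(z in Xi) (enorm (G x z - gradient f x) ^+ 2)%:E)%E.
Proof.
rewrite [RHS]integral_mkcond; apply: eq_integral => z _.
rewrite patchE /noise; case: ifP => _; first by rewrite sqr_enorm.
by rewrite /dotv mulmx0 mxE.
Qed.

End noise.

(** * Integrals of finite sums and products of real random variables *)

Section finite_sums.
Context (R : realType) (dO : measure_display) (Omega : measurableType dO)
  (P : probability Omega R).

Lemma integrable_EFin_sum (J : finType) (F : J -> Omega -> R) :
  (forall j, P.-integrable setT (fun w => (F j w)%:E)) ->
  P.-integrable setT (fun w => (\sum_j F j w)%:E).
Proof.
move=> iF; under eq_fun do rewrite -sumEFin.
by apply: integrable_sum => // j _; exact: iF.
Qed.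

Lemma integral_EFin_sum (J : finType) (F : J -> Omega -> R) (e : J -> R) :
  (forall j, P.-integrable setT (fun w => (F j w)%:E)) ->
  (forall j, \int[P]_w (F j w)%:E = (e j)%:E)%E ->
  (\int[P]_w (\sum_j F j w)%:E = (\sum_j e j)%:E)%E.
Proof.
move=> iF Fe; under eq_integral do rewrite -sumEFin.
rewrite integral_sum// -sumEFin.
by apply: eq_bigr => j _; exact: Fe.
Qed.

Lemma integrable_EFinM (r : R) (h : Omega -> R) :
  P.-integrable setT (fun w => (h w)%:E) ->
  P.-integrable setT (fun w => (r * h w)%:E).
Proof. by move=> ih; under eq_fun do rewrite EFinM; exact: integrableZl. Qed.

Lemma integral_EFinM (r e : R) (h : Omega -> R) :
  P.-integrable setT (fun w => (h w)%:E) ->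
  (\int[P]_w (h w)%:E = e%:E)%E ->
  (\int[P]_w (r * h w)%:E = (r * e)%:E)%E.
Proof.
by move=> ih he; under eq_integral do rewrite EFinM; rewrite integralZl// he.
Qed.

(** The product is dominated by [X w ^+ 2 + Y w ^+ 2]. *)
Lemma integrable_mul_sqr (X Y : Omega -> R) :
  measurable_fun setT X -> measurable_fun setT Y ->
  P.-integrable setT (fun w => (X w ^+ 2)%:E) ->
  P.-integrable setT (fun w => (Y w ^+ 2)%:E) ->
  P.-integrable setT (fun w => (X w * Y w)%:E).
Proof.
move=> mX mY iX iY.
apply: (le_integrable measurableT) (integrableD measurableT iX iY).
  by apply/measurable_EFinP; exact: measurable_funM.
move=> w _ /=; rewrite lee_fin normrM.
rewrite [leRHS]ger0_norm ?addr_ge0 ?sqr_ge0//.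
rewrite -[X w ^+ 2]real_normK ?num_real// -[Y w ^+ 2]real_normK ?num_real//.
by have := normr_ge0 (X w); have := normr_ge0 (Y w); nra.
Qed.

End finite_sums.

(** * Variance reduction by averaging over a batch *)

Section batch.
Context (R : realType) (dO : measure_display) (Omega : measurableType dO)
  (P : probability Omega R).
Context (n b : nat) (delta : 'I_b -> 'I_n -> Omega -> R)
  (q : 'I_n -> Omega -> R) (c s2 : R).
Hypotheses (b0 : (0 < b)%N) (c0 : 0 <= c).
Hypotheses (mdelta : forall i a, measurable_fun setT (delta i a))
  (mq : forall a, measurable_fun setT (q a)).
Hypotheses
  (idelta : forall i a, P.-integrable setT (fun w => (delta i a w ^+ 2)%:E))
  (iq : forall a, P.-integrable setT (fun w => (q a w ^+ 2)%:E)).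
Hypothesis q_delta : forall i a, (\int[P]_w (q a w * delta i a w)%:E = 0)%E.
Hypothesis delta_orth : forall i j a, i != j ->
  (\int[P]_w (delta i a w * delta j a w)%:E = 0)%E.
Hypothesis delta_var : forall i,
  (\int[P]_w (\sum_a delta i a w ^+ 2)%:E <= s2%:E)%E.

Definition batch_mean a w := b%:R^-1 * \sum_i delta i a w.

(** The remainder <q, e> + c |e|^2 of the descent inequality, with e the batch mean, written in
    coordinates. *)
Definition batch_excess w :=
  \sum_a q a w * batch_mean a w + c * \sum_a batch_mean a w ^+ 2.

Let bR0 : 0 < b%:R :> R. Proof. by rewrite ltr0n. Qed.

Let excessE w : batch_excess w =
  \sum_a \sum_i b%:R^-1 * (q a w * delta i a w) +
  \sum_a \sum_i \sum_j c / b%:R ^+ 2 * (delta i a w * delta j a w).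
Proof.
rewrite /batch_excess /batch_mean; congr (_ + _).
  by apply: eq_bigr => a _; rewrite mulrCA !mulr_sumr.
rewrite mulr_sumr; apply: eq_bigr => a _.
rewrite expr2 mulrACA -expr2 mulr_suml mulrA exprVn mulr_sumr.
by apply: eq_bigr => i _; rewrite mulr_sumr mulr_sumr.
Qed.

Let iqd a i : P.-integrable setT (fun w => (q a w * delta i a w)%:E).
Proof. exact: integrable_mul_sqr. Qed.

Let idd a i j : P.-integrable setT (fun w => (delta i a w * delta j a w)%:E).
Proof. exact: integrable_mul_sqr. Qed.

Let i1 : P.-integrable setT
  (fun w => (\sum_a \sum_i b%:R^-1 * (q a w * delta i a w))%:E).
Proof.
apply: integrable_EFin_sum => a; apply: integrable_EFin_sum => i.
exact: integrable_EFinM.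
Qed.

Let i2 : P.-integrable setT (fun w =>
  (\sum_a \sum_i \sum_j c / b%:R ^+ 2 * (delta i a w * delta j a w))%:E).
Proof.
apply: integrable_EFin_sum => a; apply: integrable_EFin_sum => i.
apply: integrable_EFin_sum => j; exact: integrable_EFinM.
Qed.

Lemma batch_excess_integrable :
  P.-integrable setT (fun w => (batch_excess w)%:E).
Proof.
under eq_fun do rewrite excessE EFinD; exact: integrableD.
Qed.

(* Only the diagonal terms of the square survive: this is where the factor
   [b^-1] comes from. *)
Lemma batch_excess_le :
  (\int[P]_w (batch_excess w)%:E <= (c * (s2 / b%:R))%:E)%E.
Proof.
under eq_integral do rewrite excessE EFinD.
rewrite integralD//.
rewrite (@integral_EFin_sum _ _ _ _ _ _ (fun a => \sum_(i < b) 0)); first last.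
- move=> a; apply: integral_EFin_sum => i; first exact: integrable_EFinM.
  by rewrite (@integral_EFinM _ _ _ _ _ 0) ?mulr0// q_delta.
- move=> a; apply: integrable_EFin_sum => i; exact: integrable_EFinM.
rewrite big1 ?add0e => [|a _]; last by rewrite big1.
pose e i a := fine (\int[P]_w (delta i a w ^+ 2)%:E)%E.
have eE i a : (\int[P]_w (delta i a w ^+ 2)%:E = (e i a)%:E)%E.
  by rewrite fineK//; exact: integrable_fin_num.
rewrite (@integral_EFin_sum _ _ _ _ _ _
  (fun a => \sum_i \sum_j c / b%:R ^+ 2 * (if i == j then e i a else 0))); first last.
- move=> a; apply: integral_EFin_sum => i.
    apply: integrable_EFin_sum => j; exact: integrable_EFinM.
  apply: integral_EFin_sum => j; first exact: integrable_EFinM.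
  apply: integral_EFinM => //.
  by case: eqVneq => [<-|ij]; [exact: eE|exact: delta_orth].
- move=> a; apply: integrable_EFin_sum => i; apply: integrable_EFin_sum => j.
  exact: integrable_EFinM.
rewrite lee_fin.
have sume i : \sum_a e i a <= s2.
  by rewrite -lee_fin -(integral_EFin_sum (idelta i) (eE i)).
(* Summing over the coordinates of one sample first brings in its variance bound. *)
rewrite exchange_big /=.
apply: (@le_trans _ _ (\sum_(i < b) c / b%:R ^+ 2 * s2)).
  apply: ler_sum => i _.
  rewrite (eq_bigr (fun a => c / b%:R ^+ 2 * e i a)) => [|a _]; last first.
    rewrite (bigD1 i)//= eqxx big1 ?addr0// => j ji.
    by rewrite eq_sym (negbTE ji) mulr0.
  by rewrite -mulr_sumr ler_wpM2l// divr_ge0// exprn_ge0// ltW.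
rewrite sumr_const card_ord -mulr_natr le_eqVlt; apply/orP; left; apply/eqP.
by field; rewrite gt_eqF.
Qed.

End batch.

(** * The surrogate run: measurability and agreement with the actual run *)

Section surrogate.
Context (R : realType) (n d : nat) (f : 'cV[R]_n -> R) (flow L sigma m M : R)
  (Xi : set 'cV[R]_d) (G : 'cV[R]_n -> 'cV[R]_d -> 'cV[R]_n)
  (x1 : 'cV[R]_n) (B1 : 'M[R]_n) (N : nat) (alpha : nat -> R)
  (batch : nat -> nat) (PR : nat -> R)
  (dO : measure_display) (Omega : measurableType dO) (P : probability Omega R)
  (run : rsqn_run n d P).
Hypotheses (smooth : AS1 f flow L) (oracle : stochastic_oracle Xi G)
  (alg : is_RSQN Xi G x1 B1 N alpha batch PR run)
  (as2 : AS2 f Xi G sigma N batch run) (as4 : AS4 N batch run).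

Local Notation X := (fun p => xi run p.1 p.2 : Omega -> borel_cV R d).
Local Notation OmegaS D := (g_sigma_algebraType (sigma_of_gen X D)).
Local Notation Omega_ k := (OmegaS (samples_upto batch k)).

(* The run with the oracle replaced by the exact gradient outside of [Xi]; it is
   almost surely equal to the run, but measurable with respect to the samples.
   Numbered from 0: [surrogate k] stands for x_(k+1). *)
Fixpoint surrogate (k : nat) (w : Omega) : 'cV[R]_n :=
  if k is k'.+1 then
    surrogate k' w - alpha k *: (inv_hess run k w *m
      (gradient f (surrogate k' w) + (batch k)%:R^-1 *:
         \sum_(i < batch k) noise f Xi G (surrogate k' w) (xi run k i.+1 w)))
  else x1.

(** The matrix used at iteration [k.+1] is known after [k] batches: the first one is the constant
    [B1], the later ones are covered by AS4. *)
Lemma hess_coord_measurable k (a b : 'I_n) : (k < N)%N ->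
  measurable_fun setT ((fun w => hess run k.+1 w a b) : Omega_ k -> R).
Proof.
case: k => [|k] kN.
  rewrite (_ : (fun w => _) = fun=> B1 a b); first exact: measurable_cst.
  by apply/funext => w; rewrite (rsqn_B1 alg).
apply: (@measurable_coord_comp R _ (Omega_ k.+1) setT n n (hess run k.+2)) => _ Y mY.
by rewrite setTI; exact: (as4 (k := k.+2)).
Qed.

Lemma inv_hess_coord_measurable k (a b : 'I_n) : (k < N)%N ->
  measurable_fun setT ((fun w => inv_hess run k.+1 w a b) : Omega_ k -> R).
Proof.
move=> kN.
rewrite (_ : (fun w => _) = fun w => invmx (hess run k.+1 w) a b +
  (zeta run k.+1)%:M a b); last by apply/funext => w; rewrite mxE.
apply: measurable_funD => //.
apply: measurable_invmx => [w|a' b']; last exact: hess_coord_measurable.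
by apply: spd_unitmx; exact: (rsqn_hess_spd alg).
Qed.

Lemma samples_upto_sub k l : (k <= l)%N ->
  samples_upto batch k `<=` samples_upto batch l.
Proof.
by move=> kl [i j] [/= /andP[i0 ik] jb]; split => //=; rewrite i0 (leq_trans ik).
Qed.

Lemma samples_uptoS k (i : 'I_(batch k.+1)) : samples_upto batch k.+1 (k.+1, i.+1).
Proof. by split => /=; rewrite ?leqnn// ltn_ord. Qed.

Lemma samples_uptoN k i : ~ samples_upto batch k (k.+1, i).
Proof. by move=> [/andP[_]] /=; rewrite ltnn. Qed.

Lemma noise_comp_measurable (D : set (nat * nat)) k (i : 'I_(batch k.+1)) a
    (x : Omega -> borel_cV R n) : D (k.+1, i.+1) ->
  measurable_fun setT (x : OmegaS D -> borel_cV R n) ->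
  measurable_fun setT ((fun w => noise f Xi G (x w) (xi run k.+1 i.+1 w) a 0)
    : OmegaS D -> R).
Proof.
move=> Di mx.
have mn := noise_measurable a (AS1_continuous smooth) oracle.
apply: (@measurableT_comp _ _ _ _ _ _ _ _ (fun w : OmegaS D =>
  (x w, xi run k.+1 i.+1 w : borel_cV R d)) mn).
apply: measurable_fun_pair => //.
exact: (@sigma_of_gen_measurable_fun Omega _ (borel_cV R d) _ X D (k.+1, i.+1)).
Qed.

Lemma surrogate_measurable k : (k <= N)%N ->
  measurable_fun setT (surrogate k : Omega_ k -> borel_cV R n).
Proof.
elim: k => [|k IH] kN; first exact: measurable_cst.
have mk : measurable_fun setT (surrogate k : Omega_ k.+1 -> borel_cV R n).
  exact: sigma_of_gen_sub (samples_upto_sub (leqnSn k)) (IH (ltnW kN)).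
apply: measurable_fun_coordP => a b; rewrite (ord1 b).
have -> : (fun w => surrogate k.+1 w a 0) =
  (fun w => surrogate k w a 0 - alpha k.+1 * (inv_hess run k.+1 w *m
      (gradient f (surrogate k w) + (batch k.+1)%:R^-1 *:
         \sum_(i < batch k.+1) noise f Xi G (surrogate k w) (xi run k.+1 i.+1 w)))
    a 0).
  by apply/funext => w /=; rewrite !mxE.
apply: measurable_funB; first exact: measurable_coord_comp.
apply: measurable_funM => //.
apply: (@measurable_mulmx R _ (Omega_ k.+1) setT n n 1) => [i j|i j].
  apply: sigma_of_gen_sub (samples_upto_sub (leqnSn k)) _.
  exact: inv_hess_coord_measurable.
rewrite (ord1 j) (_ : (fun w => _) = fun w => gradient f (surrogate k w) i 0 +
    (batch k.+1)%:R^-1 * \sum_(l < batch k.+1)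
      noise f Xi G (surrogate k w) (xi run k.+1 l.+1 w) i 0); last first.
  by apply/funext => w; rewrite mxE [X in _ + X]mxE summxE.
apply: measurable_funD.
  exact: measurableT_comp (gradient_coord_measurable i (AS1_continuous smooth)) mk.
apply: measurable_funM => //; apply: measurable_sum => l.
by apply: noise_comp_measurable => //; exact: samples_uptoS.
Qed.

(** Almost surely every sample of the batch lies in [Xi], where gradient plus noise is the oracle
    value. *)
Lemma surrogate_eq_iterate k : (k <= N)%N ->
  {ae P, forall w, surrogate k w = iterate run k.+1 w}.
Proof.
elim: k => [|k IH] kN.
  by apply: aeW => w; rewrite /= (rsqn_x1 alg).
have supp : {ae P, forall w, forall i : 'I_(batch k.+1), Xi (xi run k.+1 i.+1 w)}.
  apply: filter_forall => i; have mXi := oracle.1.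
  have mpre : measurable (xi run k.+1 i.+1 @^-1` Xi).
    by rewrite -[_ @^-1` _]setTI; exact: (measurable_funP (xi run k.+1 i.+1)).
  exists (~` (xi run k.+1 i.+1 @^-1` Xi)); split => //; first exact: measurableC.
  by rewrite probability_setC// (rsqn_support alg) ?subee//= ltn_ord.
have b0 : (batch k.+1)%:R != 0 :> R.
  by rewrite pnatr_eq0 -lt0n (rsqn_batch alg).
move: (IH (ltnW kN)) supp; apply: filterS2 => w xE wXi.
rewrite (rsqn_step alg) ?kN//= -xE; congr (_ - _ *: (_ *m _)).
rewrite /batch_gradient -xE big_add1 big_mkord.
(* The gradient is written as the mean of [batch k.+1] copies of itself and absorbed in the sum. *)
rewrite -[X in X + _](scalerK b0) -scalerDr; congr (_ *: _).
rewrite scaler_nat -[X in _ *+ X]card_ord -sumr_const -big_split /=.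
by apply: eq_bigr => i _; rewrite /noise mem_set// addrC subrK.
Qed.

(** * Orthogonality and variance of the sample noise *)

Let mX p : measurable_fun setT (X p).
Proof. exact: (measurable_funP (xi run p.1 p.2)). Qed.

Let gen_measurable D : <<s sigma_of_gen X D >> `<=` measurable.
Proof. exact: (@sigma_of_measurable _ _ _ _ _ X D mX). Qed.

Let gen_indep k i D : (k < N)%N -> (i < batch k.+1)%N ->
  D `<=` samples_upto batch N -> ~ D (k.+1, i.+1) ->
  forall A B, <<s sigma_of_gen X D >> A -> measurable B ->
  P (A `&` xi run k.+1 i.+1 @^-1` B) = (P A * P (xi run k.+1 i.+1 @^-1` B))%E.
Proof.
move=> kN ib DN Di.
apply: (mutually_independent_sigma_of (X := X) (j := (k.+1, i.+1)) mX
  (AS2_independent as2) DN) => //.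
Qed.

Let surrogate_measurable_sub k D : (k <= N)%N -> samples_upto batch k `<=` D ->
  measurable_fun setT (surrogate k : OmegaS D -> borel_cV R n).
Proof. by move=> kN kD; exact: sigma_of_gen_sub kD (surrogate_measurable kN). Qed.

Lemma surrogate_restricted_measurable k : (k <= N)%N ->
  measurable_fun setT (surrogate k : Omega -> borel_cV R n).
Proof.
move=> kN; apply: restricted_measurable_fun (surrogate_measurable kN).
exact: gen_measurable.
Qed.

Definition sample_noise k (i : 'I_(batch k.+1)) (a : 'I_n) (w : Omega) : R :=
  noise f Xi G (surrogate k w) (xi run k.+1 i.+1 w) a 0.

Let noise_pair_measurable k a D : (k <= N)%N -> samples_upto batch k `<=` D ->
  measurable_fun setT (fun p : OmegaS D * borel_cV R d =>
    noise f Xi G (surrogate k p.1) p.2 a 0).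
Proof.
move=> kN kD.
have mn := noise_measurable a (AS1_continuous smooth) oracle.
apply: (@measurableT_comp _ _ _ _ _ _ _ _ (fun p : OmegaS D * borel_cV R d =>
  (surrogate k p.1 : borel_cV R n, p.2)) mn).
apply: measurable_fun_pair => //.
exact: measurableT_comp (surrogate_measurable_sub kN kD) measurable_fst.
Qed.

Let sample_noise_measurable_sub k i a D : (k <= N)%N ->
  samples_upto batch k `<=` D -> D (k.+1, (i : 'I_(batch k.+1)).+1) ->
  measurable_fun setT (sample_noise i a : OmegaS D -> R).
Proof.
move=> kN kD Di; apply: noise_comp_measurable => //.
exact: surrogate_measurable_sub.
Qed.

Lemma sample_noise_measurable k (i : 'I_(batch k.+1)) a : (k <= N)%N ->
  measurable_fun setT (sample_noise i a).
Proof.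
move=> kN; apply: (restricted_measurable_fun (F := sigma_of_gen X setT)).
  exact: gen_measurable.
exact: sample_noise_measurable_sub.
Qed.

Let noise_frozen k (i : 'I_(batch k.+1)) : (k < N)%N ->
  {ae P, forall w : Omega, forall a,
    (distribution P (xi run k.+1 i.+1)).-integrable setT
      (fun z => (noise f Xi G (surrogate k w) z a 0)%:E) /\
    (\int[distribution P (xi run k.+1 i.+1)]_z
       (noise f Xi G (surrogate k w) z a 0)%:E = 0)%E}.
Proof.
move=> kN.
have kN' : (1 <= k.+1 <= N)%N by [].
have ib : (1 <= i.+1 <= batch k.+1)%N by rewrite /= ltn_ord.
move: (surrogate_eq_iterate (ltnW kN)) (AS2_unbiased as2 kN' ib).
apply: filterS2 => w -> h a; have [h1 h2] := h a.
by apply: noise_mean0 => //; [exact: oracle.1|exact: (rsqn_support alg)].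
Qed.

(** Here [D] is any past that determines [c] and omits the sample. It serves twice: with the samples
    of earlier iterations for the linear term, and with one more sample of the same batch for the
    cross terms. *)
Lemma sample_noise_orthogonal k (i : 'I_(batch k.+1)) a D (c : Omega -> R) :
  (k < N)%N -> samples_upto batch k `<=` D -> D `<=` samples_upto batch N ->
  ~ D (k.+1, i.+1) -> measurable_fun setT (c : OmegaS D -> R) ->
  P.-integrable setT (fun w => (c w * sample_noise i a w)%:E) ->
  (\int[P]_w (c w * sample_noise i a w)%:E = 0)%E.
Proof.
move=> kN kD DN Di mc ic.
apply: (@freezing_orthogonal R _ Omega P _ (borel_cV R d) (sigma_of_gen X D)
  (xi run k.+1 i.+1) _ _ c (fun p => noise f Xi G (surrogate k p.1) p.2 a 0)) => //.
- exact: gen_indep.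
- exact: noise_pair_measurable (ltnW kN) kD.
- by move: (noise_frozen i kN); apply: filterS => w h; exact: h.
Qed.

(** Freezing the past turns the second moment into the inner integral that AS2 bounds. *)
Lemma sample_noise_variance k (i : 'I_(batch k.+1)) : (k < N)%N ->
  (\int[P]_w (\sum_a sample_noise i a w ^+ 2)%:E <= (sigma ^+ 2)%:E)%E.
Proof.
move=> kN.
have kN' : (1 <= k.+1 <= N)%N by [].
have ib : (1 <= i.+1 <= batch k.+1)%N by rewrite /= ltn_ord.
pose phi (p : Omega_ k * borel_cV R d) :=
  (\sum_a noise f Xi G (surrogate k p.1) p.2 a 0 ^+ 2)%:E.
have mphi : measurable_fun setT phi.
  apply/measurable_EFinP; apply: measurable_sum => a; apply: measurable_funX.
  exact: noise_pair_measurable (ltnW kN) _.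
have phi0 p : (0 <= phi p)%E by rewrite lee_fin sumr_ge0// => a _; exact: sqr_ge0.
rewrite (@freezing R _ Omega P _ (borel_cV R d) (sigma_of_gen X (samples_upto batch k))
  (xi run k.+1 i.+1) _ _ phi)//; last first.
  apply: gen_indep => //; first exact: samples_upto_sub (ltnW kN).
  exact: samples_uptoN.
have -> : ((sigma ^+ 2)%:E = \int[P]_w (cst (sigma ^+ 2)%:E w))%E.
  rewrite integral_cst// [X in (_ * X)%E](_ : _ = 1%E) ?mule1//.
  exact: probability_setT.
apply: ae_ge0_le_integral => //.
- by move=> w _; exact: integral_ge0.
- apply: (restricted_measurable_fun (F := sigma_of_gen X (samples_upto batch k))).
    exact: gen_measurable.
  exact: measurable_fun_fubini_tonelli_F.
- by move=> w _; rewrite lee_fin sqr_ge0.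
move: (surrogate_eq_iterate (ltnW kN)) (AS2_variance as2 kN' ib).
apply: filterS2 => w xE h _; rewrite -xE in h.
rewrite -noise_second_moment in h.
apply: le_trans h; rewrite le_eqVlt; apply/orP; left; apply/eqP.
by apply: eq_integral => z _; rewrite /phi dotvE.
Qed.

Lemma sample_noise_sqr_integrable k (i : 'I_(batch k.+1)) a : (k < N)%N ->
  P.-integrable setT (fun w => (sample_noise i a w ^+ 2)%:E).
Proof.
move=> kN; have ms b := sample_noise_measurable i b (ltnW kN).
apply/integrableP; split; first exact/measurable_EFinP/measurable_funX.
apply: (@le_lt_trans _ _ (sigma ^+ 2)%:E); last exact: ltry.
apply: le_trans (sample_noise_variance i kN).
apply: ge0_le_integral => //.
- exact/measurableT_comp/measurable_EFinP/measurable_funX.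
- by apply/measurable_EFinP; apply: measurable_sum => b; exact: measurable_funX.
move=> w _; rewrite abse_EFin lee_fin ger0_norm ?sqr_ge0//.
by rewrite (bigD1 a)//= lerDl sumr_ge0// => b _; exact: sqr_ge0.
Qed.

(** * Expected descent of the objective gap and telescoping *)

Hypotheses (as3 : AS3 m M N run) (m0 : 0 < m) (M0 : 0 < M)
  (alpha0 : forall k, 0 <= alpha k).

Definition gap k (w : Omega) : R := f (surrogate k w) - flow.

Definition sqr_grad k (w : Omega) : R :=
  dotv (gradient f (surrogate k w)) (gradient f (surrogate k w)).

Let coef k (a : 'I_n) (w : Omega) : R :=
  noise_coefficient f L M (inv_hess run k.+1 w) (alpha k.+1) (surrogate k w) a 0.

Let weight k := L * alpha k.+1 ^+ 2 * M ^+ 2 / 2.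

Let excess k w := batch_excess (@sample_noise k) (coef k) (weight k) w.

Lemma gap_ge0 k w : 0 <= gap k w.
Proof. by rewrite subr_ge0; exact: AS1_lower_bound smooth _. Qed.

Lemma gap_measurable k : (k <= N)%N -> measurable_fun setT (gap k).
Proof.
move=> kN; apply: measurable_funB => //.
apply: (@measurableT_comp _ _ _ _ _ _ (f : borel_cV R n -> R) _ (surrogate k));
  last exact: surrogate_restricted_measurable.
apply: continuous_borel_measurable => x.
exact/differentiable_continuous/(AS1_differentiable smooth).
Qed.

Lemma sqr_grad_measurable k : (k <= N)%N ->
  measurable_fun setT (sqr_grad k : Omega_ N -> R).
Proof.
move=> kN.
have ms : measurable_fun setT (surrogate k : Omega_ N -> borel_cV R n).
  by apply: surrogate_measurable_sub => //; exact: samples_upto_sub.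
rewrite (_ : sqr_grad k = fun w => \sum_a gradient f (surrogate k w) a 0 *
  gradient f (surrogate k w) a 0); last by apply/funext => w; exact: dotvE.
apply: measurable_sum => a.
have mg := measurableT_comp (gradient_coord_measurable a (AS1_continuous smooth)) ms.
exact: measurable_funM.
Qed.

Lemma sqr_grad_restricted_measurable k : (k <= N)%N ->
  measurable_fun setT (sqr_grad k).
Proof.
move=> kN; apply: restricted_measurable_fun (sqr_grad_measurable kN).
exact: gen_measurable.
Qed.

Let coef_measurable k a : (k < N)%N -> measurable_fun setT (coef k a : Omega_ k -> R).
Proof.
move=> kN; have ms := surrogate_measurable (ltnW kN).
have mg b := measurableT_comp (gradient_coord_measurable b (AS1_continuous smooth)) ms.
rewrite (_ : coef k a = fun w => L * alpha k.+1 ^+ 2 * M ^+ 2 *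
    gradient f (surrogate k w) a 0 - alpha k.+1 *
    (inv_hess run k.+1 w *m gradient f (surrogate k w)) a 0); last first.
  apply/funext => w; rewrite /coef /noise_coefficient.
  by rewrite mxE [X in X + _]mxE [X in _ + X]mxE [X in - X]mxE.
apply: measurable_funB; apply: measurable_funM => //; first exact: mg.
apply: (@measurable_mulmx R _ (Omega_ k) setT n n 1) => i j.
  exact: inv_hess_coord_measurable.
by rewrite (ord1 j); exact: mg.
Qed.

Let coef_restricted_measurable k a : (k < N)%N -> measurable_fun setT (coef k a).
Proof.
move=> kN; apply: restricted_measurable_fun (coef_measurable a kN).
exact: gen_measurable.
Qed.

Let coef_sqr_integrable k a : (k < N)%N ->
  (\int[P]_w (gap k w)%:E < +oo)%E ->
  P.-integrable setT (fun w => (coef k a w ^+ 2)%:E).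
Proof.
move=> kN gap_oo.
have mc := coef_restricted_measurable a kN.
have mgap := gap_measurable (ltnW kN).
apply/integrableP; split; first exact/measurable_EFinP/measurable_funX.
pose K := (2 * (L * alpha k.+1 ^+ 2 * M ^+ 2) ^+ 2
  + 2 * alpha k.+1 ^+ 2 * M ^+ 2) * (2 * L).
have K0 : 0 <= K.
  by rewrite /K !(mulr_ge0, addr_ge0, sqr_ge0, ler0n)// ltW// (AS1_L_gt0 smooth).
apply: (@le_lt_trans _ _ (\int[P]_w (K * gap k w)%:E)%E); last first.
  under eq_integral do rewrite EFinM.
  rewrite ge0_integralZl//; first by rewrite lte_mul_pinfty.
  - exact/measurable_EFinP.
  - by move=> w _; rewrite lee_fin gap_ge0.
apply: ae_ge0_le_integral => //.
- exact/measurableT_comp/measurable_EFinP/measurable_funX.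
- by move=> w _; rewrite lee_fin mulr_ge0// gap_ge0.
- by apply/measurable_EFinP; exact: measurable_funM.
have kN' : (1 <= k.+1 <= N)%N by [].
move: (as3 kN'); apply: filterS => w [mH HM] _.
rewrite abse_EFin lee_fin ger0_norm ?sqr_ge0//.
apply: le_trans (noise_coefficient_sqr_le smooth m0 M0 (alpha k.+1) mH HM
  (surrogate k w) a) _.
by rewrite /K /gap le_eqVlt; apply/orP; left; apply/eqP; ring.
Qed.

Let excess_properties k : (k < N)%N -> (\int[P]_w (gap k w)%:E < +oo)%E ->
  P.-integrable setT (fun w => (excess k w)%:E) /\
  (\int[P]_w (excess k w)%:E <= (weight k * (sigma ^+ 2 / (batch k.+1)%:R))%:E)%E.
Proof.
move=> kN gap_oo.
have ms i a := @sample_noise_measurable k i a (ltnW kN).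
have mc a := coef_restricted_measurable a kN.
have is2 i a := @sample_noise_sqr_integrable k i a kN.
have ic2 a := coef_sqr_integrable a kN gap_oo.
split; first exact: batch_excess_integrable.
apply: batch_excess_le => //.
- by rewrite (rsqn_batch alg).
- by rewrite /weight !(mulr_ge0, sqr_ge0)// ltW// (AS1_L_gt0 smooth).
- move=> i a; apply: (@sample_noise_orthogonal k i a (samples_upto batch k)) => //.
  + exact: samples_upto_sub (ltnW kN).
  + exact: samples_uptoN.
  + exact: coef_measurable.
  + exact: integrable_mul_sqr.
- move=> i j a ij.
  (* Adding sample [i] to the past makes its noise measurable, and sample [j] is still fresh because
     the indices differ. *)
  pose D := samples_upto batch k `|` [set (k.+1, i.+1)].
  have kD : samples_upto batch k `<=` D by exact: subsetUl.
  apply: (@sample_noise_orthogonal k j a D) => //.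
  + move=> p [/(samples_upto_sub (ltnW kN))//|->].
    exact: (samples_upto_sub kN (samples_uptoS i)).
  + move=> [|[/val_inj ji]]; first exact: samples_uptoN.
    by rewrite ji eqxx in ij.
  + by apply: sample_noise_measurable_sub => //; [exact: ltnW|right].
  + exact: integrable_mul_sqr.
- by move=> i; exact: sample_noise_variance.
Qed.

Let descent_ae k : (k < N)%N -> {ae P, forall w,
  gap k.+1 w + step_weight m M L alpha k.+1 * sqr_grad k w <= gap k w + excess k w}.
Proof.
move=> kN; have kN' : (1 <= k.+1 <= N)%N by [].
move: (as3 kN'); apply: filterS => w [mH HM].
set e := (batch k.+1)%:R^-1 *:
  \sum_(i < batch k.+1) noise f Xi G (surrogate k w) (xi run k.+1 i.+1 w).
have := quasi_newton_descent smooth m0 M0 mH HM (alpha0 k.+1) (surrogate k w) e.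
have eE a : e a 0 = batch_mean (@sample_noise k) a w.
  by rewrite /e /batch_mean mxE summxE.
have -> : excess k w = dotv (noise_coefficient f L M (inv_hess run k.+1 w)
    (alpha k.+1) (surrogate k w)) e + weight k * dotv e e.
  rewrite /excess /batch_excess !dotvE; congr (_ + _ * _).
    by apply: eq_bigr => a _; rewrite eE.
  by apply: eq_bigr => a _; rewrite eE expr2.
rewrite /gap /sqr_grad /step_weight /weight /= -/e.
set u := f _; set v := f _; lra.
Qed.

(** The integrals on the left have nonnegative integrands and live in the extended reals, so
    finiteness of the expected gap at [k.+1] is a consequence and not a premise. *)
Lemma expected_descent k : (k < N)%N -> 0 <= step_weight m M L alpha k.+1 ->
  (\int[P]_w (gap k w)%:E < +oo)%E ->
  (\int[P]_w (gap k.+1 w)%:E +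
     (step_weight m M L alpha k.+1)%:E * \int[P]_w (sqr_grad k w)%:E <=
   \int[P]_w (gap k w)%:E +
     (weight k * (sigma ^+ 2 / (batch k.+1)%:R))%:E)%E.
Proof.
move=> kN sw0 gap_oo.
have [iZ leZ] := excess_properties kN gap_oo.
have mgap := gap_measurable (ltnW kN); have mgap' := gap_measurable kN.
have msq := sqr_grad_restricted_measurable (ltnW kN).
have sq0 w : 0 <= sqr_grad k w by exact: dotv_ge0.
have igap : P.-integrable setT (fun w => (gap k w)%:E).
  apply/integrableP; split; first exact/measurable_EFinP.
  apply: le_lt_trans gap_oo; rewrite le_eqVlt; apply/orP; left; apply/eqP.
  by apply: eq_integral => w _; rewrite abse_EFin ger0_norm// gap_ge0.
apply: le_trans (leeD (lexx _) leZ).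
rewrite -integralD// -ge0_integralZl//; first last.
- by move=> w _; rewrite lee_fin sq0.
- exact/measurable_EFinP.
rewrite -ge0_integralD//; first last.
- by apply: measurable_funeM; exact/measurable_EFinP.
- by move=> w _; rewrite mule_ge0 ?lee_fin.
- exact/measurable_EFinP.
- by move=> w _; rewrite lee_fin gap_ge0.
have irhs : P.-integrable setT (fun w => (gap k w)%:E + (excess k w)%:E)%E.
  exact: integrableD.
have lhs0 w : (0 <= (gap k.+1 w)%:E + (step_weight m M L alpha k.+1)%:E * (sqr_grad k w)%:E)%E.
  by rewrite -EFinM -EFinD lee_fin addr_ge0 ?gap_ge0// mulr_ge0.
(* The dominating integrand is known to be nonnegative only almost surely; its absolute value serves
   for the comparison and is then removed almost everywhere. *)
apply: (@le_trans _ _ (\int[P]_w `|(gap k w)%:E + (excess k w)%:E|)%E).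
  apply: ae_ge0_le_integral => //.
  - apply: emeasurable_funD; first exact/measurable_EFinP.
    by apply: measurable_funeM; exact/measurable_EFinP.
  - by apply: measurableT_comp => //; exact: measurable_int irhs.
  move: (descent_ae kN); apply: filterS => w h _.
  by rewrite -EFinM -!EFinD abse_EFin lee_fin (le_trans h)// ler_norm.
rewrite le_eqVlt; apply/orP; left; apply/eqP; apply: ae_eq_integral => //.
- by apply: measurableT_comp => //; exact: measurable_int irhs.
- exact: measurable_int irhs.
move: (descent_ae kN); apply: filterS => w h _.
rewrite -EFinD abse_EFin ger0_norm//; apply: le_trans h.
by rewrite addr_ge0 ?gap_ge0// mulr_ge0.
Qed.

Lemma expected_telescope k : (k <= N)%N ->
  (forall j, 0 <= step_weight m M L alpha j) ->
  (\int[P]_w (gap k w)%:E +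
     \sum_(j < k) (step_weight m M L alpha j.+1)%:E * \int[P]_w (sqr_grad j w)%:E <=
   (f x1 - flow + \sum_(j < k)
      (L * alpha j.+1 ^+ 2 * M ^+ 2 / 2 * (sigma ^+ 2 / (batch j.+1)%:R)))%:E)%E.
Proof.
move=> kN sw0; elim: k kN => [|k IH] kN.
  rewrite !big_ord0 !addr0 /gap /= integral_cst//.
  by rewrite [X in (_ * X)%E](_ : _ = 1%E) ?mule1//; exact: probability_setT.
have sum0 : (0 <= \sum_(j < k) (step_weight m M L alpha j.+1)%:E *
    \int[P]_w (sqr_grad j w)%:E)%E.
  apply: sume_ge0 => j _; rewrite mule_ge0 ?lee_fin//.
  by apply: integral_ge0 => w _; rewrite lee_fin dotv_ge0.
have {}IH := IH (ltnW kN).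
(* The induction hypothesis itself supplies the finiteness that the next descent step requires. *)
have gap_oo : (\int[P]_w (gap k w)%:E < +oo)%E.
  by apply: le_lt_trans (ltry _); apply: le_trans IH; rewrite leeDl.
have step := expected_descent kN (sw0 _) gap_oo.
rewrite !big_ord_recr /= [in leRHS]addrA; move: step IH; rewrite /weight.
set A1 := integral _ _ _; set W := (_ * _)%E; set A0 := integral _ _ _.
set S := (\sum_(j < k) _)%E => step IH.
rewrite (addeC S W) addeA; apply: le_trans (leeD step (lexx S)) _.
by rewrite addeAC [leRHS]EFinD; apply: leeD.
Qed.

(** * The random output index *)

Let rindex_indep A (B : set nat) : <<s sigma_of_gen X (samples_upto batch N) >> A ->
  measurable B ->
  P (A `&` rindex run @^-1` B) = (P A * P (rindex run @^-1` B))%E.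
Proof.
move=> sA mB; rewrite setIC muleC; apply: (rsqn_rindex_indep alg) => //.
by exists B => //; rewrite setTI.
Qed.

Let iterate_sqr_grad_measurable k : measurable_fun setT (fun w =>
  dotv (gradient f (iterate run k w)) (gradient f (iterate run k w))).
Proof.
rewrite (_ : (fun w => _) = fun w => \sum_a gradient f (iterate run k w) a 0 *
  gradient f (iterate run k w) a 0); last by apply/funext => w; exact: dotvE.
apply: measurable_sum => a.
have mg := measurableT_comp (gradient_coord_measurable a (AS1_continuous smooth))
  (measurable_funP (iterate run k)).
exact: measurable_funM.
Qed.

(** Exactly one indicator is nonzero because the index lies between 1 and [N]; the predecessor
    accounts for numbering from 0. *)
Let rindex_sum (F : nat -> R) w :
  \sum_(k < N) (rindex run w == k.+1)%:R * F k = F (rindex run w).-1.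
Proof.
have := rsqn_rindex_range alg w; case: (rindex run w) => [//|r] /= rN.
rewrite (bigD1 (Ordinal rN))//= eqxx mul1r big1 ?addr0// => k kr.
rewrite eqSS; case: eqVneq => [rk|_]; last by rewrite mul0r.
by move: kr; rewrite -val_eqE /= rk eqxx.
Qed.

Let rindex_iterate w : iterate run (rindex run w) w =
  iterate run (rindex run w).-1.+1 w.
Proof.
by have := rsqn_rindex_range alg w; case: (rindex run w).
Qed.

(** Freezing again: all samples now form the past and the output index is the fresh variable, whose
    law produces the weights. *)
Lemma expected_sqr_grad_mixture :
  (expected_sqr_grad f run =
   \sum_(k < N) (PR k.+1)%:E * \int[P]_w (sqr_grad k w)%:E)%E.
Proof.
pose phi (p : Omega_ N * nat) := (\sum_(k < N) (p.2 == k.+1)%:R * sqr_grad k p.1)%:E.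
have mnat (h : nat -> R) : measurable_fun setT h by [].
have sq0 k w : 0 <= sqr_grad k w by exact: dotv_ge0.
have mphi : measurable_fun setT phi.
  apply/measurable_EFinP; apply: measurable_sum => k; apply: measurable_funM.
    exact: (measurableT_comp (mnat (fun r => (r == k.+1)%:R)) measurable_snd).
  exact: measurableT_comp (sqr_grad_measurable (ltnW (ltn_ord k))) measurable_fst.
have phi0 p : (0 <= phi p)%E.
  by rewrite lee_fin sumr_ge0// => k _; rewrite mulr_ge0.
have mrindex (h : nat -> R) : measurable_fun setT (fun w => h (rindex run w)).
  exact: measurableT_comp (mnat h) (measurable_funP (rindex run)).
transitivity (\int[P]_w phi (w, rindex run w))%E.
  rewrite /expected_sqr_grad unlock.
  under eq_integral do rewrite /= sqr_enorm.
  apply: ge0_ae_eq_integral => //.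
  - rewrite (_ : (fun w => _) = fun w => (\sum_(k < N) (rindex run w == k.+1)%:R *
      dotv (gradient f (iterate run k.+1 w)) (gradient f (iterate run k.+1 w)))%:E).
      apply/measurable_EFinP; apply: measurable_sum => k; apply: measurable_funM.
        exact: (mrindex (fun r => (r == k.+1)%:R)).
      exact: iterate_sqr_grad_measurable.
    apply/funext => w; rewrite rindex_iterate (rindex_sum (fun k =>
      dotv (gradient f (iterate run k.+1 w)) (gradient f (iterate run k.+1 w)))).
    by [].
  - apply: (joint_measurable_fun (F := sigma_of_gen X (samples_upto batch N))) => //.
  - by move=> w _; rewrite lee_fin dotv_ge0.
  (* Finitely many almost sure equalities hold simultaneously, so the random index may be
     substituted for [k] afterwards. *)
  have : {ae P, forall w, forall k : 'I_N, surrogate k w = iterate run k.+1 w}.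
    by apply: filter_forall => k; exact: surrogate_eq_iterate (ltnW (ltn_ord k)).
  apply: filterS => w h _; rewrite rindex_iterate /phi /= (rindex_sum (fun k => sqr_grad k w)).
  rewrite /sqr_grad.
  have rN : ((rindex run w).-1 < N)%N.
    by have := rsqn_rindex_range alg w; case: (rindex run w).
  by rewrite (h (Ordinal rN)).
rewrite (@freezing R _ Omega P _ nat (sigma_of_gen X (samples_upto batch N))
  (rindex run) _ rindex_indep phi)//.
transitivity (\int[P]_w (\sum_(k < N) (PR k.+1)%:E * (sqr_grad k w)%:E))%E.
  apply: eq_integral => w _; rewrite /phi /=.
  under eq_integral do rewrite -sumEFin.
  rewrite ge0_integral_sum//; last first.
    by move=> k r _; rewrite lee_fin mulr_ge0.
  apply: eq_bigr => k _.
  under eq_integral do rewrite mulrC EFinM.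
  rewrite ge0_integralZl//; last by rewrite lee_fin.
  rewrite muleC; congr (_ * _)%E.
  rewrite -(rsqn_rindex_pmf alg (k := k.+1)) ?ltn_ord//.
  transitivity (\int[distribution P (rindex run)]_r (\1_[set k.+1] r)%:E)%E.
    apply: eq_integral => r _; rewrite indicE.
    rewrite (_ : (r == k.+1) = (r \in [set k.+1]))//.
    by apply/eqP/idP; rewrite inE.
  by rewrite integral_indic// setIT.
have PR0 (k : 'I_N) : (0 <= (PR k.+1)%:E)%E.
  by rewrite -(rsqn_rindex_pmf alg (k := k.+1)) ?ltn_ord.
have msq (k : 'I_N) : measurable_fun setT (fun w => (sqr_grad k w)%:E).
  by apply/measurable_EFinP/sqr_grad_restricted_measurable/ltnW.
rewrite ge0_integral_sum//; last 2 first.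
- by move=> k; exact: measurable_funeM.
- by move=> k w _; rewrite mule_ge0// lee_fin.
by apply: eq_bigr => k _; rewrite ge0_integralZl// => w _; rewrite lee_fin.
Qed.

End surrogate.

(** * The bound for constant step and batch size *)

Section constant_parameters.
Context (R : realType) (n d : nat) (f : 'cV[R]_n -> R) (flow L sigma m M : R)
  (Xi : set 'cV[R]_d) (G : 'cV[R]_n -> 'cV[R]_d -> 'cV[R]_n)
  (x1 : 'cV[R]_n) (B1 : 'M[R]_n) (N b : nat)
  (dO : measure_display) (Omega : measurableType dO) (P : probability Omega R)
  (run : rsqn_run n d P).
Let alpha (_ : nat) : R := m / (L * M ^+ 2).
Let batch (_ : nat) := b.
Hypotheses (smooth : AS1 f flow L) (oracle : stochastic_oracle Xi G)
  (m0 : 0 < m) (M0 : 0 < M) (N0 : (0 < N)%N)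
  (alg : is_RSQN Xi G x1 B1 N alpha batch (PR_weighted m M L alpha N) run)
  (as2 : AS2 f Xi G sigma N batch run) (as3 : AS3 m M N run)
  (as4 : AS4 N batch run).

(** For this stepsize the weight of |g|^2 and the coefficient of the variance both equal s = m^2 /
    (2 L M^2), and [PR_weighted] is uniform. Dividing the telescoped inequality by N s gives the
    bound. *)
Lemma expected_sqr_grad_le :
  (expected_sqr_grad f run <=
   (2 * L * M ^+ 2 * (f x1 - flow) / (m ^+ 2 * N%:R) + sigma ^+ 2 / b%:R)%:E)%E.
Proof.
have L0 := AS1_L_gt0 smooth.
have NR0 : 0 < N%:R :> R by rewrite ltr0n.
pose s : R := m ^+ 2 / (2 * L * M ^+ 2).
have s0 : 0 < s by rewrite divr_gt0 ?exprn_gt0// !mulr_gt0 ?exprn_gt0.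
have swE k : step_weight m M L alpha k = s.
  by rewrite /step_weight /alpha /s; field; rewrite !gt_eqF.
have weightE : L * (m / (L * M ^+ 2)) ^+ 2 * M ^+ 2 / 2 = s.
  by rewrite /s; field; rewrite !gt_eqF.
have alpha0 k : 0 <= alpha k by rewrite /alpha divr_ge0 ?mulr_ge0 ?exprn_ge0 ?ltW.
have PRE k : PR_weighted m M L alpha N k = N%:R^-1.
  rewrite /PR_weighted swE (eq_bigr (fun=> s)) => [|j _]; last exact: swE.
  rewrite sumr_const_nat subSS subn0 -mulr_natr.
  by field; rewrite !gt_eqF.
have sw0 k : 0 <= step_weight m M L alpha k by rewrite swE ltW.
have := expected_telescope smooth oracle alg as2 as4 as3 m0 M0 alpha0 (leqnn N) sw0.
rewrite (expected_sqr_grad_mixture smooth oracle alg as4).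
set sg := sqr_grad f Xi G x1 alpha batch run => telescope.
have I0 k : (0 <= \int[P]_w (sg k w)%:E)%E.
  by apply: integral_ge0 => w _; rewrite lee_fin dotv_ge0.
have {telescope} : (\sum_(k < N) s%:E * \int[P]_w (sg k w)%:E <=
    (f x1 - flow + N%:R * (s * (sigma ^+ 2 / b%:R)))%:E)%E.
  under eq_bigr => k _ do rewrite -(swE k.+1).
  apply: le_trans (_ : _ <= _ + _)%E _; first last.
    apply: le_trans telescope _.
    by rewrite /alpha /batch weightE big_const_ord iter_addr_0 mulr_natl.
  by rewrite leeDr// integral_ge0// => w _; rewrite lee_fin subr_ge0 (AS1_lower_bound smooth).
move=> h.
rewrite (eq_bigr (fun k : 'I_N => (N%:R * s)^-1%:E * (s%:E * \int[P]_w (sg k w)%:E))%E).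
  rewrite -ge0_sume_distrr => [|k _]; last by rewrite mule_ge0// lee_fin ltW.
  have c0 : 0 < (N%:R * s)^-1 by rewrite invr_gt0 mulr_gt0.
  apply: le_trans (lee_wpmul2l _ h) _; first by rewrite lee_fin ltW.
  rewrite -EFinM lee_fin le_eqVlt; apply/orP; left; apply/eqP.
  (* At [b] zero both variance quotients vanish by the convention on inverses. *)
  have [->|b0] := eqVneq (b%:R : R) 0.
    rewrite invr0 !mulr0 !addr0 /s; field; rewrite !gt_eqF//.
  by rewrite /s; field; rewrite b0 !gt_eqF.
move=> k _; rewrite PRE muleA -EFinM; congr (_%:E * _)%E.
by field; rewrite !gt_eqF.
Qed.

End constant_parameters.

(** * Budgets of order eps^(-2) and the count of oracle calls *)

Lemma sufficient_budget_exists (R : realType) (L sigma m M Dt Df : R) :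
  exists Nbar : R -> nat,
    ((fun eps : R => (Nbar eps)%:R : R) =O_ (0^'+) (fun eps : R => eps ^- 2)) /\
    forall eps, sufficient_budget L sigma m M Dt Df eps (Nbar eps).
Proof.
set c1 := C1 L sigma m M Dt Df; set c2 := C2 L m M Df.
set e0 := sigma ^+ 2 / (L ^+ 2 * Dt).
pose target eps := Num.max (c1 ^+ 2 / eps ^+ 2 + 4 * c2 / eps) e0.
(* The absolute value dominates the ceiling whatever its sign, and the successor makes the budget
   positive. *)
exists (fun eps => (absz (Num.ceil (target eps))).+1); split; last first.
  move=> eps; split => //; rewrite -/c1 -/c2 -/e0 -/(target eps).
  apply: le_trans (ceil_ge _) _; rewrite -natr1.
  apply: le_trans (ler_norm _) _.
  by rewrite -intr_norm -abszE lerDl.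
(* For eps in the open unit interval, with y its inverse, 1 and y are at most y^2; the final 2 pays
   for the ceiling and the successor. *)
apply/eqO_exP; exists (c1 ^+ 2 + 4 * `|c2| + `|e0| + 2) => /=.
  by rewrite ltr_wpDl// addr_ge0// addr_ge0 ?sqr_ge0// mulr_ge0.
near=> eps.
have eps0 : 0 < eps by near: eps; exact: nbhs_right_gt.
have eps1 : eps < 1 by near: eps; apply: nbhs_right_lt.
have i1 : 1 <= eps^-1 by rewrite invf_ge1// ltW.
set y := eps^-1 in i1 *.
have -> : eps ^- 2 = y ^+ 2 by rewrite exprVn.
rewrite (@ger0_norm _ _.+1%:R)// (@ger0_norm _ (y ^+ 2)) ?sqr_ge0//.
have tE : `|target eps| <= c1 ^+ 2 * y ^+ 2 + 4 * `|c2| * y + `|e0|.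
  have h : `|c1 ^+ 2 / eps ^+ 2 + 4 * c2 / eps| <= c1 ^+ 2 * y ^+ 2 + 4 * `|c2| * y.
    apply: le_trans (ler_normD _ _) _; rewrite -exprVn -/y.
    rewrite (@ger0_norm _ (_ * y ^+ 2)); last by rewrite mulr_ge0// sqr_ge0.
    by rewrite !normrM (ger0_norm (le_trans ler01 i1)) ger0_norm.
  have h0 := le_trans (normr_ge0 _) h; have e00 := normr_ge0 e0.
  by rewrite /target /Num.max; case: ifP => _; rewrite ?lerDr// (le_trans h)// lerDl.
have cE : `|Num.ceil (target eps)|%N%:R <= `|target eps| + 1 :> R.
  have [h1 h2] := (ceilB1_lt (target eps), ceil_ge (target eps)).
  rewrite -[leLHS]/((Posz `|Num.ceil (target eps)|%N)%:~R) abszE intr_norm.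
  have := ler_norm (target eps); have := ler_norm (- target eps).
  rewrite normrN => h3 h4; rewrite ler_norml; move: h1; rewrite intrB => h1.
  by apply/andP; split; lra.
rewrite -natr1.
have y2 : y <= y ^+ 2 by rewrite expr2 ler_peMl// (le_trans _ i1).
have h5 := ler_wpM2l (normr_ge0 c2) y2.
have h6 : `|e0| <= `|e0| * y ^+ 2 by rewrite ler_peMr// (le_trans i1).
have h7 : 1 <= y ^+ 2 := le_trans i1 y2.
lra.
Unshelve. all: by end_near.
Qed.

Theorem corollary3p4 (R : realType) (n d : nat)
    (f : 'cV[R]_n -> R) (flow L sigma m M Dt : R)
    (Xi : set 'cV[R]_d) (G : 'cV[R]_n -> 'cV[R]_d -> 'cV[R]_n)
    (x1 : 'cV[R]_n) (B1 : 'M[R]_n) :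
  AS1 f flow L ->
  stochastic_oracle Xi G ->
  0 < sigma -> 0 < m -> 0 < M -> 0 < Dt ->
  let Df := f x1 - flow in
  let alpha := fun _ : nat => m / (L * M ^+ 2) in
  let batch := fun Nbar _ : nat => mbar L sigma Dt Nbar in
  let N := fun Nbar : nat => (Nbar %/ mbar L sigma Dt Nbar)%N in
  let admissible_run := fun (Nbar : nat)
      (dO : measure_display) (Omega : measurableType dO)
      (P : probability Omega R) (run : rsqn_run n d P) =>
    [/\ is_RSQN Xi G x1 B1 (N Nbar) alpha (batch Nbar)
          (PR_weighted m M L alpha (N Nbar)) run,
        AS2 f Xi G sigma (N Nbar) (batch Nbar) run,
        AS3 m M (N Nbar) run &
        AS4 (N Nbar) (batch Nbar) run] in
  (forall (eps : R) (Nbar : nat),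
     0 < eps -> sufficient_budget L sigma m M Dt Df eps Nbar ->
     forall (dO : measure_display) (Omega : measurableType dO)
       (P : probability Omega R) (run : rsqn_run n d P),
       admissible_run Nbar dO Omega P run ->
       (expected_sqr_grad f run <= eps%:E)%E)
  /\
  (exists Nbar : R -> nat,
     [/\ (fun eps : R => (Nbar eps)%:R : R) =O_ (0^'+) (fun eps : R => eps ^- 2),
         (forall eps : R, 0 < eps ->
            sufficient_budget L sigma m M Dt Df eps (Nbar eps)) &
         forall eps : R, 0 < eps ->
           forall (dO : measure_display) (Omega : measurableType dO)
             (P : probability Omega R) (run : rsqn_run n d P),
             admissible_run (Nbar eps) dO Omega P run ->
             (expected_sqr_grad f run <= eps%:E)%E /\
             forall w, (oracle_calls (batch (Nbar eps)) run w <= Nbar eps)%N]).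
Proof.
move=> smooth oracle s0 m0 M0 Dt0 Df alpha batch N admissible_run.
have L0 := AS1_L_gt0 smooth.
have Df0 : 0 <= Df by rewrite subr_ge0; exact: AS1_lower_bound smooth _.
have bound eps Nbar : 0 < eps -> sufficient_budget L sigma m M Dt Df eps Nbar ->
    forall (dO : measure_display) (Omega : measurableType dO)
      (P : probability Omega R) (run : rsqn_run n d P),
    admissible_run Nbar dO Omega P run -> (expected_sqr_grad f run <= eps%:E)%E.
  move=> e0 budget dO Omega P run [alg as2 as3 as4].
  have N0 := iterations_gt0 L0 s0 Dt0 budget.
  apply: le_trans (expected_sqr_grad_le smooth oracle m0 M0 N0 alg as2 as3 as4) _.
  by rewrite lee_fin; exact: sufficient_budget_bound.
split; first exact: bound.
have [Nbar [NbarO budget]] := sufficient_budget_exists L sigma m M Dt Df.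
exists Nbar; split => // eps e0 dO Omega P run adm.
split; first exact: bound (budget eps) _ _ _ _ adm.
(* A run makes [mbar] calls in each of its R iterations, and R is at most the quotient of the budget
   by [mbar]. *)
move=> w; rewrite /oracle_calls sum_nat_const_nat subSS subn0.
have [alg _ _ _] := adm.
have /andP[_ RN] := rsqn_rindex_range alg w.
apply: leq_trans (leq_trunc_div (Nbar eps) (mbar L sigma Dt (Nbar eps))).
by rewrite leq_mul2r RN orbT.
Qed.
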